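(* Fix an integer $d\geq 2$. There is a constant $c>0$ such that the following holds. Suppose that for some $\varepsilon>0$ there is an algorithm which, given two rooted unordered trees $H$ and $G$, each with at most $n$ vertices, in which every vertex has at most $d$ children and whose heights are at most $2\log_d n + c\log\log n$, decides in time $O(n^{2-\varepsilon})$ whether $H$ is isomorphic to a subtree of $G$. Then the Strong Exponential Time Hypothesis (SETH) is false.
   Context: Rooted Subtree Isomorphism: given rooted unordered trees $H$ and $G$, decide whether $H$ is isomorphic to a subtree of $G$, i.e. whether there is an injective map $f$ from the vertices of $H$ to the vertices of $G$ with $f(\mathrm{root}(H))=\mathrm{root}(G)$ such that whenever $c$ is a child of $p$ in $H$, $f(c)$ is a child of $f(p)$ in $G$. The height of a rooted tree is the maximum number of edges on a root-to-leaf path. SETH (Strong Exponential Time Hypothesis): for every $\varepsilon>0$ there is an integer $k$ such that $k$-SAT on $n$ variables cannot be solved in time $O(2^{(1-\varepsilon)n}\mathrm{poly}(n))$. *)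

(* Defs.v *)
From Stdlib Require PeanoNat.
From mathcomp Require Import all_boot all_order all_algebra.
From mathcomp Require Import reals exp.

Set Implicit Arguments.
Unset Strict Implicit.
Unset Printing Implicit Defensive.

Import Order.TTheory GRing.Theory Num.Theory.
Local Open Scope ring_scope.

(** * Rooted unordered trees *)

(* The vertices are numbered in an arbitrary way and each vertex points to its
   parent; the root, which has no parent, points to itself.  Nothing orders
   the children of a vertex. *)
Record rtree := RTree {
  tsize : nat;
  root : 'I_tsize;
  parent : {ffun 'I_tsize -> 'I_tsize};
  parent_root : parent root = root;
  root_reachable : forall v, fconnect parent v root
}.

Section Trees.
Variable T : rtree.
Implicit Types v c p : 'I_(tsize T).

Definition child c p : bool := (c != root T) && (parent T c == p).

Definition nchildren p : nat := #|[pred c | child c p]|.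

Definition leaf v : bool := nchildren v == 0%N.

(* [findex f x y] is the least [k] such that [iter k f x = y]. *)
Definition depth v : nat := findex (parent T) v (root T).

Definition height : nat := \max_(v | leaf v) depth v.

Definition encode_tree : seq nat :=
  tsize T :: val (root T) :: [seq val (parent T v) | v <- enum 'I_(tsize T)].

End Trees.

Definition iso_to_subtree (H G : rtree) : Prop :=
  exists f : 'I_(tsize H) -> 'I_(tsize G),
    [/\ injective f,
        f (root H) = root G
      & forall c p, child c p -> child (f c) (f p)].

(** * Satisfiability of CNF formulas *)

(* [(i, true)] is the variable [x_i] and [(i, false)] is its negation. *)
Definition literal (n : nat) : Type := ('I_n * bool)%type.
Definition clause (n : nat) : Type := seq (literal n).
Definition cnf (n : nat) : Type := seq (clause n).

(* A formula is a set of clauses.  As no clause is listed twice, the length of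
   a [k]-CNF on [n] variables is polynomial in [n] for each fixed [k], so that
   running times can be measured in [n] alone. *)
Definition kcnf (k n : nat) (phi : cnf n) : bool :=
  uniq (phi : seq (seq ('I_n * bool))) && all (fun cl => size cl <= k)%N phi.

Definition satisfiable (n : nat) (phi : cnf n) : Prop :=
  exists a : {ffun 'I_n -> bool},
    all (fun cl : clause n => has (fun l : literal n => a l.1 == l.2) cl) phi.

Definition encode_literal (n : nat) (l : literal n) : nat :=
  (val l.1).*2 + l.2.

Definition encode_cnf (n : nat) (phi : cnf n) : seq nat :=
  n :: size phi ::
  flatten [seq size cl :: [seq encode_literal l | l <- cl] | cl : clause n <- phi].

(** * Word RAM *)

(* Structured programs over registers [r_0, r_1, ...] and a random access
   memory indexed by words.  Each operation has unit cost. *)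
Inductive binop :=
  | Add | Sub | Mul | Div | Mod | And | Or | Xor | Shl | Shr | Eq | Lt.

(* Subtraction is truncated at 0, and [x / 0 = 0], [x mod 0 = x]. *)
Definition eval_binop (o : binop) (x y : nat) : nat :=
  match o with
  | Add => (x + y)%N
  | Sub => (x - y)%N
  | Mul => (x * y)%N
  | Div => (x %/ y)%N
  | Mod => (x %% y)%N
  | And => PeanoNat.Nat.land x y
  | Or => PeanoNat.Nat.lor x y
  | Xor => PeanoNat.Nat.lxor x y
  | Shl => (x * 2 ^ y)%N
  | Shr => (x %/ 2 ^ y)%N
  | Eq => nat_of_bool (x == y)
  | Lt => nat_of_bool (x < y)%N
  end.

Inductive prog :=
  | Skip
  | Const (r v : nat)                    (* r := v *)
  | Op (r : nat) (o : binop) (a b : nat) (* r := a o b *)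
  | Fetch (r a : nat)                    (* r := mem[a] *)
  | Store (a r : nat)                    (* mem[a] := r *)
  | Seq (p q : prog)
  | If (r : nat) (p q : prog)
  | While (r : nat) (p : prog).

Record state := State { reg : nat -> nat; mem : nat -> nat }.

Definition upd (f : nat -> nat) (a v : nat) : nat -> nat :=
  fun x => if x == a then v else f x.

Definition set_reg (s : state) (r v : nat) : state :=
  State (upd (reg s) r v) (mem s).

Definition set_mem (s : state) (a v : nat) : state :=
  State (reg s) (upd (mem s) a v).

(* [exec w p s t s']: on [w]-bit words, [p] started in [s] halts in [s'] after
   [t] steps.  A word has to be smaller than [2 ^ w]: there is no wrap-around,
   and an execution that overflows is stuck. *)
Inductive exec (w : nat) : prog -> state -> nat -> state -> Prop :=
  | ExecSkip s :
      exec w Skip s 1 s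
  | ExecConst s r v :
      (v < 2 ^ w)%N ->
      exec w (Const r v) s 1 (set_reg s r v)
  | ExecOp s r o a b :
      (eval_binop o (reg s a) (reg s b) < 2 ^ w)%N ->
      exec w (Op r o a b) s 1 (set_reg s r (eval_binop o (reg s a) (reg s b)))
  | ExecFetch s r a :
      (mem s (reg s a) < 2 ^ w)%N ->
      exec w (Fetch r a) s 1 (set_reg s r (mem s (reg s a)))
  | ExecStore s a r :
      exec w (Store a r) s 1 (set_mem s (reg s a) (reg s r))
  | ExecSeq p q s1 t1 s2 t2 s3 :
      exec w p s1 t1 s2 -> exec w q s2 t2 s3 ->
      exec w (Seq p q) s1 (t1 + t2)%N s3
  | ExecIfTrue r p q s t s' :
      reg s r != 0%N -> exec w p s t s' ->
      exec w (If r p q) s t.+1 s'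
  | ExecIfFalse r p q s t s' :
      reg s r == 0%N -> exec w q s t s' ->
      exec w (If r p q) s t.+1 s'
  | ExecWhileTrue r p s1 t1 s2 t2 s3 :
      reg s1 r != 0%N -> exec w p s1 t1 s2 -> exec w (While r p) s2 t2 s3 ->
      exec w (While r p) s1 (t1 + t2).+1 s3
  | ExecWhileFalse r p s :
      reg s r == 0%N ->
      exec w (While r p) s 1 s.

(* The input is stored from address 0 on; everything else is 0. *)
Definition init (input : seq nat) : state :=
  State (fun=> 0%N) (nth 0%N input).

(* The answer is read in [r_0], any nonzero word meaning "yes". *)
Definition decides (R : realType) (p : prog) (w : nat) (time : R)
    (input : seq nat) (answer : Prop) : Prop :=
  exists t s, [/\ exec w p (init input) t s,
                  t%:R <= time
                & reg s 0 != 0%N <-> answer].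

(** * The two complexity hypotheses *)

Definition logb (R : realType) (b x : R) : R := ln x / ln b.

Definition admissible (R : realType) (d : nat) (c : R) (n : nat) (T : rtree) :
    Prop :=
  [/\ (tsize T <= n)%N,
      forall v : 'I_(tsize T), (nchildren v <= d)%N
    & (height T)%:R <= 2 * logb d%:R n%:R + c * logb 2 (logb 2 n%:R)].

(* Time [O(n ^ (2 - e))] on words of [O(log n)] bits. *)
Definition subtree_iso_solvable (R : realType) (d : nat) (c e : R) : Prop :=
  exists (p : prog) (C : nat), forall (n : nat) (H G : rtree),
    (2 <= n)%N -> admissible d c n H -> admissible d c n G ->
    decides p (C * up_log 2 n) (C%:R * n%:R `^ (2 - e))
      (encode_tree H ++ encode_tree G) (iso_to_subtree H G).

(* Time [O(2 ^ ((1 - e) n) poly(n))].  Words have [O(n)] bits, that is, the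
   order of the logarithm of the running time, as is needed to address a
   memory of exponential size. *)
Definition ksat_solvable (R : realType) (k : nat) (e : R) : Prop :=
  exists (p : prog) (C : nat), forall (n : nat) (phi : cnf n),
    kcnf k phi ->
    decides p (C * n.+1) (C%:R * 2 `^ ((1 - e) * n%:R) * n.+1%:R ^+ C)
      (encode_cnf phi) (satisfiable phi).

Definition SETH (R : realType) : Prop :=
  forall e : R, 0 < e -> exists k : nat, ~ ksat_solvable k e.

(* Main.v *)
(* A formula on n variables is satisfiable iff some assignment b of one half of
   the variables and some assignment a of the other half satisfy, for every
   clause, that b or a satisfies it.  With N = d ^ l >= 2 ^ (n / 2), let H be the
   complete d-ary tree of depth l in which the leaf number b continues with a path
   of length l and then a gadget for b.  In G all leaves but one continue with a
   path and a gadget that contains every gadget of H, and the last one with a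
   second complete d-ary tree, whose leaves carry the gadgets of all a.  An
   embedding of H into G sends exactly one leaf b to the last leaf of G, and the
   path below it to a branch of the second tree, so it selects a pair (b, a); the
   gadget of b embeds into the one of a iff this pair satisfies the formula.

   The trees have N * poly(n) vertices and height 2 * l + O(log n).  A polynomial
   factor in the size bound pays for the O(log n), so no sparsification is needed,
   and an algorithm of time M ^ (2 - e) on trees of size M = 2 ^ (n / 2) * poly(n)
   decides satisfiability in time 2 ^ ((1 - e / 2) * n) * poly(n). *)

From Stdlib Require PeanoNat.
Require Import Defs.
From mathcomp Require Import all_boot all_order all_algebra.
From mathcomp Require Import reals exp.
From mathcomp Require Import zify lra.
Import Defs.

Set Implicit Arguments.
Unset Strict Implicit.
Unset Printing Implicit Defensive.

Local Open Scope nat_scope.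

(** * Compiling expressions to the word RAM *)

(** An overflowing run is stuck and every instruction counts, so the reduction has to be a program
    all of whose intermediate values and loop lengths are bounded. It is written in a small language
    that is compiled once and for all. The trees are numbered so that the parent of a vertex is an
    arithmetic function of its number; one loop over the numbers then writes a tree. A second loop
    over vertices nested in it would cost about [2 ^ n], so only loops of polynomial length occur
    inside. The tree algorithm is a black box that expects its input at address 0 and all registers
    0. It is run on the memory behind the formula, after a reduction that has left its registers
    untouched. On the combinatorial side, the obstacle is that siblings may be permuted freely.
    Counting forces some leaf onto the last leaf, and the gadgets have to be rigid so that
    coordinates cannot be mixed up. Conversely, an arbitrary leaf [b] has to be brought to the last
    position by an automorphism explicit enough to be checked level by level; this is [twist]. *)

Inductive expr :=
  | Var (i : nat)
  | Lit (c : nat)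
  | Bin (o : binop) (a b : expr)
  | Read (a : expr)
  | Ite (c a b : expr)
  | Iter (cnt ini body : expr).

(* The body of [Iter] sees two more variables: the accumulator and the
   iteration counter. *)
Fixpoint eval (m : nat -> nat) (vs : seq nat) (e : expr) : nat :=
  match e with
  | Var i => nth 0 vs i
  | Lit c => c
  | Bin o a b => eval_binop o (eval m vs a) (eval m vs b)
  | Read a => m (eval m vs a)
  | Ite c a b => if eval m vs c != 0 then eval m vs a else eval m vs b
  | Iter cnt ini body =>
      iteri (eval m vs cnt) (fun i acc => eval m (vs ++ [:: acc; i]) body)
        (eval m vs ini)
  end.

(** Values of [eval] are unbounded naturals, so every subterm that is evaluated must stay below
    [2 ^ w] for the machine to follow. [Q] caps the iterations of each loop, and with them the
    cost. *)
Fixpoint safe (w Q : nat) (m : nat -> nat) (vs : seq nat) (e : expr) : Prop :=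
  eval m vs e < 2 ^ w /\
  match e with
  | Var i => i < size vs
  | Lit c => True
  | Bin o a b => safe w Q m vs a /\ safe w Q m vs b
  | Read a => safe w Q m vs a
  | Ite c a b =>
      safe w Q m vs c /\
      if eval m vs c != 0 then safe w Q m vs a else safe w Q m vs b
  | Iter cnt ini body =>
      [/\ safe w Q m vs cnt, safe w Q m vs ini, eval m vs cnt <= Q
        & forall i, i < eval m vs cnt ->
            safe w Q m (vs ++ [:: iteri i
              (fun i acc => eval m (vs ++ [:: acc; i]) body) (eval m vs ini);
              i]) body]
  end.

(* The value goes to register [r]; registers above [r] are scratch, and [rs]
   lists the registers, all below [r], that hold the variables. *)
Fixpoint compile (rs : seq nat) (r : nat) (e : expr) : prog :=
  match e with
  | Var i => Op r And (nth 0 rs i) (nth 0 rs i)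
  | Lit c => Const r c
  | Bin o a b => Seq (compile rs r a) (Seq (compile rs r.+1 b) (Op r o r r.+1))
  | Read a => Seq (compile rs r a) (Fetch r r)
  | Ite c a b => Seq (compile rs r c) (If r (compile rs r a) (compile rs r b))
  | Iter cnt ini body =>
      Seq (compile rs r ini) (Seq (compile rs r.+1 cnt) (Seq (Const r.+2 0)
        (While r.+1
          (Seq (compile (rs ++ [:: r; r.+2]) r.+3 body)
          (Seq (Op r And r.+3 r.+3)
          (Seq (Const r.+3 1)
          (Seq (Op r.+2 Add r.+2 r.+3) (Op r.+1 Sub r.+1 r.+3))))))))
  end.

Fixpoint cost (Q : nat) (e : expr) : nat :=
  match e with
  | Var _ | Lit _ => 1
  | Bin _ a b => cost Q a + cost Q b + 1
  | Read a => cost Q a + 1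
  | Ite c a b => cost Q c + cost Q a + cost Q b + 1
  | Iter cnt ini body => cost Q cnt + cost Q ini + Q * (cost Q body + 5) + 2
  end.

Definition holds (s : state) (r : nat) (rs vs : seq nat) : Prop :=
  size rs = size vs /\
  forall i, i < size vs -> nth 0 rs i < r /\ reg s (nth 0 rs i) = nth 0 vs i.

Lemma holds_preserved s s' r r' rs vs :
  r <= r' -> (forall i, i < r -> reg s' i = reg s i) ->
  holds s r rs vs -> holds s' r' rs vs.
Proof.
move=> rr' same [eqsz H]; split=> // i /H[lt_r <-]; split; first lia.
exact: same.
Qed.

Lemma holds_cat s r rs vs rs' vs' :
  holds s r rs vs -> holds s r rs' vs' -> holds s r (rs ++ rs') (vs ++ vs').
Proof.
move=> [eqsz H] [eqsz' H']; split; first by rewrite !size_cat eqsz eqsz'.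
move=> i; rewrite size_cat !nth_cat eqsz => lti.
case: (ltnP i (size vs)) => lei; first exact: H.
by apply: H'; lia.
Qed.

Definition computes (w r : nat) (p : prog) (s : state) (T v : nat) : Prop :=
  exists t s', [/\ exec w p s t s', t <= T, mem s' = mem s, reg s' r = v
                 & forall i, i < r -> reg s' i = reg s i].

Lemma updE f a v x : upd f a v x = if x == a then v else f x.
Proof. by []. Qed.

Lemma upd_eq f a v : upd f a v a = v.
Proof. by rewrite updE eqxx. Qed.

Lemma upd_ne f a v x : x <> a -> upd f a v x = f x.
Proof. by rewrite updE; case: eqP. Qed.

Ltac simp_upd :=
  rewrite /=;
  repeat (first [rewrite upd_eq | rewrite upd_ne; last by [|lia]]).

Lemma safe_lt w Q m vs e : safe w Q m vs e -> eval m vs e < 2 ^ w.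
Proof. by case: e => [?|?|? ? ?|?|? ? ?|? ? ?] []. Qed.

Lemma compileP w Q e : 0 < w -> forall m vs rs r s,
  safe w Q m vs e -> mem s = m -> holds s r rs vs ->
  computes w r (compile rs r e) s (cost Q e) (eval m vs e).
Proof.
move=> w_gt0.
have lt1 : 1 < 2 ^ w by rewrite -{1}(expn0 2) ltn_exp2l.
elim: e => [i|c|o a IHa b IHb|a IHa|c IHc a IHa b IHb|cnt IHc ini IHi body IHb]
  m vs rs r s /=.
- move=> [ltw lti] ms [_ /(_ i lti)[ltr regi]].
  exists 1, (set_reg s r (nth 0 vs i)); split=> //=.
  (* There is no move instruction; a register is copied by conjoining it with itself. *)
  + have := @ExecOp w s r And (nth 0 rs i) (nth 0 rs i).
    rewrite /= PeanoNat.Nat.land_diag regi; exact.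
  + by rewrite updE eqxx.
  + by move=> j ltj; rewrite updE; case: eqP => // ?; lia.
- move=> [ltw _] ms _.
  exists 1, (set_reg s r c); split=> //=; first exact: ExecConst.
  + by rewrite updE eqxx.
  + by move=> j ltj; rewrite updE; case: eqP => // ?; lia.
- move=> [ltw [safea safeb]] ms Hs.
  have [t1 [s1 [ex1 le1 m1 v1 R1]]] := IHa _ _ _ _ _ safea ms Hs.
  have Hs1 : holds s1 r.+1 rs vs by apply: holds_preserved Hs.
  have [t2 [s2 [ex2 le2 m2 v2 R2]]] := IHb _ _ _ r.+1 s1 safeb (etrans m1 ms) Hs1.
  exists (t1 + (t2 + 1)).
  exists (set_reg s2 r (eval_binop o (reg s2 r) (reg s2 r.+1))); split=> /=.
  + apply: ExecSeq ex1 _; apply: ExecSeq ex2 _; apply: ExecOp.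
    by rewrite R2 // v1 v2.
  + lia.
  + by rewrite m2.
  + by rewrite updE eqxx R2 // v1 v2.
  + move=> j ltj; rewrite updE; case: eqP => [?|_]; first lia.
    by rewrite R2 ?R1 //; lia.
- move=> [ltw safea] ms Hs.
  have [t1 [s1 [ex1 le1 m1 v1 R1]]] := IHa _ _ _ _ _ safea ms Hs.
  exists (t1 + 1), (set_reg s1 r (mem s1 (reg s1 r))); split=> /=.
  + by apply: ExecSeq ex1 _; apply: ExecFetch; rewrite v1 m1 ms.
  + lia.
  + by [].
  + by rewrite updE eqxx v1 m1 ms.
  + move=> j ltj; rewrite updE; case: eqP => [?|_]; first lia.
    exact: R1.
- move=> [ltw [safec safeab]] ms Hs.
  have [t1 [s1 [ex1 le1 m1 v1 R1]]] := IHc _ _ _ _ _ safec ms Hs.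
  have Hs1 : holds s1 r rs vs by apply: holds_preserved Hs.
  case: ifP safeab => [cT safea|/negbT cF safeb].
  + have [t2 [s2 [ex2 le2 m2 v2 R2]]] := IHa _ _ _ r s1 safea (etrans m1 ms) Hs1.
    exists (t1 + t2.+1), s2; split=> //.
    * by apply: ExecSeq ex1 _; apply: ExecIfTrue ex2; rewrite v1.
    * lia.
    * by rewrite m2.
    * by move=> j ltj; rewrite R2 // R1.
  + have [t2 [s2 [ex2 le2 m2 v2 R2]]] := IHb _ _ _ r s1 safeb (etrans m1 ms) Hs1.
    exists (t1 + t2.+1), s2; split=> //.
    * by apply: ExecSeq ex1 _; apply: ExecIfFalse ex2; rewrite v1 -[_ == _]negbK.
    * lia.
    * by rewrite m2.
    * by move=> j ltj; rewrite R2 // R1.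
- move=> [ltw [safec safei leQ safeb]] ms Hs.
  have [t1 [s1 [ex1 le1 m1 v1 R1]]] := IHi _ _ _ _ _ safei ms Hs.
  have Hs1 : holds s1 r.+1 rs vs by apply: holds_preserved Hs.
  have [t2 [s2 [ex2 le2 m2 v2 R2]]] := IHc _ _ _ r.+1 s1 safec (etrans m1 ms) Hs1.
  have ltc := safe_lt safec.
  set F := fun i acc => eval m (vs ++ [:: acc; i]) body in safeb *.
  set cn := eval m vs cnt in safeb ltc v2 leQ *.
  set a0 := eval m vs ini in v1 safeb *.
  (* Invariant: [n] rounds remain and [k] are done. The counter runs down because [While] tests for
     zero; the index runs up for the body. *)
  have loop n k s3 : n + k = cn -> mem s3 = m ->
      (forall i, i < r -> reg s3 i = reg s i) -> reg s3 r = iteri k F a0 ->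
      reg s3 r.+1 = n -> reg s3 r.+2 = k ->
      exists t s4,
      [/\ exec w (While r.+1 (Seq (compile (rs ++ [:: r; r.+2]) r.+3 body)
          (Seq (Op r And r.+3 r.+3) (Seq (Const r.+3 1)
          (Seq (Op r.+2 Add r.+2 r.+3) (Op r.+1 Sub r.+1 r.+3)))))) s3 t s4,
          t <= n * (cost Q body + 5) + 1, mem s4 = m, reg s4 r = iteri cn F a0
        & forall i, i < r -> reg s4 i = reg s i].
    elim: n k s3 => [|n IHn] k s3 nk m3 R3 acc3 cnt3 idx3.
      exists 1, s3; split=> //; first by apply: ExecWhileFalse; rewrite cnt3.
      by rewrite acc3 -nk.
    have Hs3 : holds s3 r.+3 (rs ++ [:: r; r.+2]) (vs ++ [:: iteri k F a0; k]).
      apply: holds_cat; first by apply: holds_preserved Hs => //; lia.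
      by split=> // -[|[|[]]] //= _; rewrite ?acc3 ?idx3; split=> //; lia.
    have ltk : k < cn by lia.
    have [t4 [s4 [ex4 le4 m4 v4 R4]]] := IHb _ _ _ _ _ (safeb k ltk) m3 Hs3.
    pose s5 := set_reg s4 r (reg s4 r.+3).
    pose s6 := set_reg s5 r.+3 1.
    pose s7 := set_reg s6 r.+2 k.+1.
    pose s8 := set_reg s7 r.+1 n.
    have [||||||t9 [s9 [ex9 le9 m9 v9 R9]]] := IHn k.+1 s8.
    + by lia.
    + by rewrite /= m4.
    + by move=> i lti; simp_upd; rewrite R4 ?R3 //; lia.
    + by simp_upd.
    + by simp_upd.
    + by simp_upd.
    exists (t4 + (1 + (1 + (1 + 1))) + t9).+1, s9; split=> //.
    * apply: ExecWhileTrue ex9; first by rewrite cnt3.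
      apply: ExecSeq ex4 _.
      apply: (@ExecSeq _ _ _ _ _ s5).
        have := @ExecOp w s4 r And r.+3 r.+3.
        rewrite /= PeanoNat.Nat.land_diag; apply.
        by rewrite v4; exact: safe_lt (safeb k ltk).
      apply: (@ExecSeq _ _ _ _ _ s6); first exact: ExecConst.
      apply: (@ExecSeq _ _ _ _ _ s7).
        have := @ExecOp w s6 r.+2 Add r.+2 r.+3.
        simp_upd; rewrite R4 ?idx3 ?addn1 //.
        by apply; lia.
      have := @ExecOp w s7 r.+1 Sub r.+1 r.+3.
      simp_upd; rewrite R4 ?cnt3 ?subn1 //.
      by apply; rewrite /=; lia.
    * by rewrite mulSn; lia.
  pose s3 := set_reg s2 r.+2 0.
  have [||||||t4 [s4 [ex4 le4 m4 v4 R4]]] := loop cn 0 s3.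
  + by rewrite addn0.
  + by rewrite /= m2 m1.
  + by move=> i lti; simp_upd; rewrite R2 ?R1 //; lia.
  + by simp_upd; rewrite R2 ?v1.
  + by simp_upd.
  + by simp_upd.
  exists (t1 + (t2 + (1 + t4))), s4; split=> //.
  + apply: ExecSeq ex1 _; apply: ExecSeq ex2 _.
    by apply: ExecSeq ex4; apply: ExecConst; lia.
  + have : cn * (cost Q body + 5) <= Q * (cost Q body + 5) by rewrite leq_mul2r leQ orbT.
    lia.
  + by rewrite m4 ms.
Qed.

(** * Commands that write to memory *)

Inductive cmd :=
  | Let (e : expr) (c : cmd)
  | Write (a v : expr)
  | Then (c1 c2 : cmd)
  | For (cnt : expr) (body : cmd).

Fixpoint run (m : nat -> nat) (vs : seq nat) (c : cmd) : nat -> nat :=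
  match c with
  | Let e c => run m (vs ++ [:: eval m vs e]) c
  | Write a v => upd m (eval m vs a) (eval m vs v)
  | Then c1 c2 => run (run m vs c1) vs c2
  | For cnt body =>
      iteri (eval m vs cnt) (fun i m' => run m' (vs ++ [:: i]) body) m
  end.

(** Two kinds of loops are bounded apart: [X] will bound the number of vertices of a tree,
    exponential in [n], and [Q] is polynomial in [n]. *)
Fixpoint csafe (w Q X : nat) (m : nat -> nat) (vs : seq nat) (c : cmd) : Prop :=
  match c with
  | Let e c => safe w Q m vs e /\ csafe w Q X m (vs ++ [:: eval m vs e]) c
  | Write a v => safe w Q m vs a /\ safe w Q m vs v
  | Then c1 c2 => csafe w Q X m vs c1 /\ csafe w Q X (run m vs c1) vs c2
  | For cnt body =>
      [/\ safe w Q m vs cnt, eval m vs cnt <= X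
        & forall i, i < eval m vs cnt ->
            csafe w Q X (iteri i (fun i m' => run m' (vs ++ [:: i]) body) m)
              (vs ++ [:: i]) body]
  end.

Fixpoint ccompile (rs : seq nat) (r : nat) (c : cmd) : prog :=
  match c with
  | Let e c => Seq (compile rs r e) (ccompile (rs ++ [:: r]) r.+1 c)
  | Write a v => Seq (compile rs r a) (Seq (compile rs r.+1 v) (Store r r.+1))
  | Then c1 c2 => Seq (ccompile rs r c1) (ccompile rs r c2)
  | For cnt body =>
      Seq (compile rs r cnt) (Seq (Const r.+1 0)
        (While r
          (Seq (ccompile (rs ++ [:: r.+1]) r.+2 body)
          (Seq (Const r.+2 1)
          (Seq (Op r.+1 Add r.+1 r.+2) (Op r Sub r r.+2))))))
  end.

Fixpoint ccost (Q X : nat) (c : cmd) : nat :=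
  match c with
  | Let e c => cost Q e + ccost Q X c
  | Write a v => cost Q a + cost Q v + 1
  | Then c1 c2 => ccost Q X c1 + ccost Q X c2
  | For cnt body => cost Q cnt + X * (ccost Q X body + 4) + 2
  end.

Lemma ccompileP w Q X c : 0 < w -> forall vs rs r s,
  csafe w Q X (mem s) vs c -> holds s r rs vs ->
  exists t s', [/\ exec w (ccompile rs r c) s t s', t <= ccost Q X c,
                   mem s' = run (mem s) vs c
                 & forall i, i < r -> reg s' i = reg s i].
Proof.
move=> w_gt0.
have lt1 : 1 < 2 ^ w by rewrite -{1}(expn0 2) ltn_exp2l.
elim: c => [e c IHc|a v|c1 IH1 c2 IH2|cnt body IHb] vs rs r s /=.
- move=> [safee safec] Hs.
  have [t1 [s1 [ex1 le1 m1 v1 R1]]] := compileP w_gt0 safee erefl Hs.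
  rewrite -m1 in safec.
  have [|t2 [s2 [ex2 le2 m2 R2]]] := IHc _ (rs ++ [:: r]) r.+1 s1 safec.
    apply: holds_cat; first by apply: holds_preserved Hs.
    by split=> // -[] //= _; rewrite v1 m1.
  exists (t1 + t2), s2; split; first exact: ExecSeq ex1 ex2.
  + by lia.
  + by rewrite m2 m1.
  + by move=> i lti; rewrite R2 ?R1 //; lia.
- move=> [safea safev] Hs.
  have [t1 [s1 [ex1 le1 m1 v1 R1]]] := compileP w_gt0 safea erefl Hs.
  have Hs1 : holds s1 r.+1 rs vs by apply: holds_preserved Hs.
  have [t2 [s2 [ex2 le2 m2 v2 R2]]] := compileP w_gt0 safev m1 Hs1.
  exists (t1 + (t2 + 1)), (set_mem s2 (reg s2 r) (reg s2 r.+1)); split=> /=.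
  + by apply: ExecSeq ex1 _; apply: ExecSeq ex2 _; apply: ExecStore.
  + by lia.
  + by rewrite m2 m1 v2 R2 ?v1.
  + by move=> i lti; rewrite R2 ?R1 //; lia.
- move=> [safe1 safe2] Hs.
  have [t1 [s1 [ex1 le1 m1 R1]]] := IH1 _ _ _ _ safe1 Hs.
  rewrite -m1 in safe2.
  have [|t2 [s2 [ex2 le2 m2 R2]]] := IH2 _ rs r s1 safe2.
    exact: holds_preserved Hs.
  exists (t1 + t2), s2; split; first exact: ExecSeq ex1 ex2.
  + by lia.
  + by rewrite m2 m1.
  + by move=> i lti; rewrite R2 ?R1.
- move=> [safec leX safeb] Hs.
  have [t1 [s1 [ex1 le1 m1 v1 R1]]] := compileP w_gt0 safec erefl Hs.
  have ltc := safe_lt safec.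
  set cn := eval (mem s) vs cnt in leX safeb v1 ltc *.
  set F := (fun i m' => run m' (vs ++ [:: i]) body) in safeb *.
  set loop := While _ _.
  have loopP n k s3 : n + k = cn -> mem s3 = iteri k F (mem s) ->
      (forall i, i < r -> reg s3 i = reg s i) ->
      reg s3 r = n -> reg s3 r.+1 = k ->
      exists t s4, [/\ exec w loop s3 t s4, t <= n * (ccost Q X body + 4) + 1,
                       mem s4 = iteri cn F (mem s)
                     & forall i, i < r -> reg s4 i = reg s i].
    elim: n k s3 => [|n IHn] k s3 nk m3 R3 cnt3 idx3.
      exists 1, s3; split=> //; first by apply: ExecWhileFalse; rewrite cnt3.
      by rewrite m3 -nk.
    have ltk : k < cn by lia.
    have := safeb k ltk; rewrite -m3 => safek.
    have [|t4 [s4 [ex4 le4 m4 R4]]] := IHb _ (rs ++ [:: r.+1]) r.+2 s3 safek.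
      apply: holds_cat; first by apply: holds_preserved Hs => //; lia.
      by split=> // -[].
    pose s5 := set_reg s4 r.+2 1.
    pose s6 := set_reg s5 r.+1 k.+1.
    pose s7 := set_reg s6 r n.
    have [|||||t9 [s9 [ex9 le9 m9 R9]]] := IHn k.+1 s7.
    + by lia.
    + by rewrite /= m4 m3.
    + by move=> i lti; simp_upd; rewrite R4 ?R3 //; lia.
    + by simp_upd.
    + by simp_upd.
    exists (t4 + (1 + (1 + 1)) + t9).+1, s9; split=> //.
    * apply: ExecWhileTrue ex9; first by rewrite cnt3.
      apply: ExecSeq ex4 _.
      apply: (@ExecSeq _ _ _ _ _ s5); first exact: ExecConst.
      apply: (@ExecSeq _ _ _ _ _ s6).
        have := @ExecOp w s5 r.+1 Add r.+1 r.+2.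
        simp_upd; rewrite R4 ?idx3 ?addn1 //.
        by apply; lia.
      have := @ExecOp w s6 r Sub r r.+2.
      simp_upd; rewrite R4 ?cnt3 ?subn1 //.
      by apply; rewrite /=; lia.
    * by rewrite mulSn; lia.
  pose s3 := set_reg s1 r.+1 0.
  have [|||||t4 [s4 [ex4 le4 m4 R4]]] := loopP cn 0 s3.
  + by rewrite addn0.
  + by rewrite /= m1.
  + by move=> i lti; simp_upd; rewrite R1.
  + by simp_upd.
  + by simp_upd.
  exists (t1 + (1 + t4)), s4; split=> //.
  + apply: ExecSeq ex1 _.
    by apply: ExecSeq ex4; apply: ExecConst; lia.
  + have : cn * (ccost Q X body + 4) <= X * (ccost Q X body + 4)
      by rewrite leq_mul2r leX orbT.
    by lia.
Qed.

(* [relocate rb rt p] runs [p] on the memory that starts at the address in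
   register [rb], using register [rt] for address computations. *)
Fixpoint relocate (rb rt : nat) (p : prog) : prog :=
  match p with
  | Fetch r a => Seq (Op rt Add a rb) (Fetch r rt)
  | Store a r => Seq (Op rt Add a rb) (Store rt r)
  | Seq p q => Seq (relocate rb rt p) (relocate rb rt q)
  | If r p q => If r (relocate rb rt p) (relocate rb rt q)
  | While r p => While r (relocate rb rt p)
  | _ => p
  end.

Fixpoint uses_below (R : nat) (p : prog) : bool :=
  match p with
  | Skip => true
  | Const r _ => r < R
  | Op r _ a b => [&& r < R, a < R & b < R]
  | Fetch r a | Store a r => (r < R) && (a < R)
  | Seq p q => uses_below R p && uses_below R q
  | If r p q => [&& r < R, uses_below R p & uses_below R q]
  | While r p => (r < R) && uses_below R p
  end.

Lemma uses_below_mono R R' p : R <= R' -> uses_below R p -> uses_below R' p.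
Proof.
move=> le_R; elim: p => //=.
- by move=> r _ ltr; lia.
- by move=> r _ a b ?; lia.
- by move=> r a ?; lia.
- by move=> a r ?; lia.
- by move=> p IHp q IHq /andP[/IHp-> /IHq->].
- by move=> r p IHp q IHq /and3P[? /IHp-> /IHq->]; lia.
- by move=> r p IHp /andP[? /IHp->]; lia.
Qed.

Lemma uses_below_exists p : exists R, uses_below R p.
Proof.
have combine q1 q2 : (exists R, uses_below R q1) -> (exists R, uses_below R q2) ->
    exists R, uses_below R q1 && uses_below R q2.
  move=> [R1 H1] [R2 H2]; exists (R1 + R2).
  by rewrite (uses_below_mono (leq_addr _ _) H1) (uses_below_mono (leq_addl _ _) H2).
elim: p => [|r v|r o a b|r a|a r|p IHp q IHq|r p IHp q IHq|r p [R HR]] /=.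
- by exists 0.
- by exists r.+1.
- by exists (r + a + b).+1; lia.
- by exists (r + a).+1; lia.
- by exists (r + a).+1; lia.
- exact: combine.
- have [R /andP[H1 H2]] := combine _ _ IHp IHq; exists (r.+1 + R).
  by rewrite !(uses_below_mono (leq_addl _ R)) // andbT; lia.
- by exists (r.+1 + R); rewrite (uses_below_mono (leq_addl _ R)) // andbT; lia.
Qed.

(** Cells below [base] are left free, since the formula stays there. *)
Definition mirrors (R base : nat) (s s' : state) : Prop :=
  [/\ forall r, r < R -> reg s' r = reg s r, reg s' R = base
    & forall x, mem s' (base + x) = mem s x].

(** Each memory access costs one more step for adding the base, hence the factor 2. Registers of the
    original run hold [w]-bit words, so addresses shifted by [base] still fit into [w'] bits. *)
Lemma relocateP R base w w' p s t s1 : 2 ^ w + base <= 2 ^ w' ->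
  exec w p s t s1 -> uses_below R p -> (forall r, reg s r < 2 ^ w) ->
  forall s', mirrors R base s s' ->
  (forall r, reg s1 r < 2 ^ w) /\
  exists t' s1', [/\ exec w' (relocate R R.+1 p) s' t' s1', t' <= 2 * t
                   & mirrors R base s1 s1'].
Proof.
move=> le_w'; have le_ww' : 2 ^ w <= 2 ^ w' by lia.
have set_lt s0 r v : v < 2 ^ w -> (forall r, reg s0 r < 2 ^ w) ->
    forall r', reg (set_reg s0 r v) r' < 2 ^ w.
  by move=> ltv H r'; rewrite /= updE; case: eqP.
have set_mirrors s0 s0' r v : mirrors R base s0 s0' ->
    r < R -> mirrors R base (set_reg s0 r v) (set_reg s0' r v).
  move=> [Hr Hb Hm] ltr; split=> //=; last by simp_upd.
  by move=> r' ltr'; rewrite !updE; case: eqP => // _; exact: Hr.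
have tmp_mirrors s0 s0' v : mirrors R base s0 s0' ->
    mirrors R base s0 (set_reg s0' R.+1 v).
  move=> [Hr Hb Hm]; split=> //=; last by simp_upd.
  by move=> r' ltr'; simp_upd; exact: Hr.
elim=> {p s t s1}.
- by move=> s _ Hlt s' Hs; split=> //; exists 1, s'; split=> //; exact: ExecSkip.
- move=> s r v ltv /= ltr Hlt s' Hs; split; first exact: set_lt.
  exists 1, (set_reg s' r v); split=> //; last exact: set_mirrors.
  by apply: ExecConst; lia.
- move=> s r o a b ltv /= /and3P[ltr lta ltb] Hlt s' Hs; split; first exact: set_lt.
  have [Hr Hb Hm] := Hs.
  exists 1, (set_reg s' r (eval_binop o (reg s a) (reg s b))); split=> //.
    rewrite -!Hr //; apply: ExecOp; rewrite !Hr //; lia.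
  exact: set_mirrors.
- move=> s r a ltv /= /andP[ltr lta] Hlt s' Hs; split; first exact: set_lt.
  have [Hr Hb Hm] := Hs.
  pose s2 := set_reg s' R.+1 (base + reg s a).
  exists (1 + 1), (set_reg s2 r (mem s (reg s a))); split=> //.
    apply: (@ExecSeq _ _ _ _ _ s2).
      have := @ExecOp w' s' R.+1 Add a R.
      rewrite /= Hr // Hb addnC; apply.
      by have := Hlt a; lia.
    have := @ExecFetch w' s2 r R.+1; simp_upd; rewrite Hm; apply; lia.
  by apply: set_mirrors => //; exact: tmp_mirrors.
- move=> s a r /= /andP[ltr lta] Hlt s' Hs; split=> //.
  have [Hr Hb Hm] := Hs.
  pose s2 := set_reg s' R.+1 (base + reg s a).
  exists (1 + 1), (set_mem s2 (base + reg s a) (reg s r)); split=> //.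
    apply: (@ExecSeq _ _ _ _ _ s2).
      have := @ExecOp w' s' R.+1 Add a R.
      rewrite /= Hr // Hb addnC; apply.
      by have := Hlt a; lia.
    have := @ExecStore w' s2 R.+1 r; simp_upd; rewrite Hr //; exact.
  split=> /=; simp_upd => //.
    by move=> r' ltr'; simp_upd; exact: Hr.
  by move=> x; rewrite !updE eqn_add2l Hm.
- move=> p q s1 t1 s2 t2 s3 _ IHp _ IHq /= /andP[Up Uq] Hlt s' Hs.
  have [Hlt2 [t1' [s2' [ex1 le1 Hs2]]]] := IHp Up Hlt s' Hs.
  have [Hlt3 [t2' [s3' [ex2 le2 Hs3]]]] := IHq Uq Hlt2 s2' Hs2.
  split=> //; exists (t1' + t2'), s3'; split=> //; first exact: ExecSeq ex1 ex2.
  by lia.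
- move=> r p q s t s1 rT _ IHp /= /and3P[ltr Up Uq] Hlt s' Hs.
  have [Hlt2 [t1' [s2' [ex1 le1 Hs2]]]] := IHp Up Hlt s' Hs.
  split=> //; exists t1'.+1, s2'; split=> //; last by lia.
  by apply: ExecIfTrue ex1; have [Hr _ _] := Hs; rewrite Hr.
- move=> r p q s t s1 rF _ IHq /= /and3P[ltr Up Uq] Hlt s' Hs.
  have [Hlt2 [t1' [s2' [ex1 le1 Hs2]]]] := IHq Uq Hlt s' Hs.
  split=> //; exists t1'.+1, s2'; split=> //; last by lia.
  by apply: ExecIfFalse ex1; have [Hr _ _] := Hs; rewrite Hr.
- move=> r p s1 t1 s2 t2 s3 rT _ IHp _ IHq /= /andP[ltr Up] Hlt s' Hs.
  have [Hlt2 [t1' [s2' [ex1 le1 Hs2]]]] := IHp Up Hlt s' Hs.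
  have [|Hlt3 [t2' [s3' [ex2 le2 Hs3]]]] := IHq _ Hlt2 s2' Hs2.
    by rewrite /= ltr.
  split=> //; exists (t1' + t2').+1, s3'; split=> //; last by lia.
  by apply: ExecWhileTrue ex1 ex2; have [Hr _ _] := Hs; rewrite Hr.
- move=> r p s rF /= /andP[ltr Up] Hlt s' Hs; split=> //.
  exists 1, s'; split=> //.
  by apply: ExecWhileFalse; have [Hr _ _] := Hs; rewrite Hr.
Qed.

(** * Numbered trees *)

(* A rooted tree on the type [node], together with a numbering [code] of its
   valid vertices by [0 .. order - 1] under which the parent function becomes
   the arithmetic function [npar]. *)
Record presentation := Presentation {
  node : Type;
  valid : node -> bool;
  par : node -> node;
  top : node;
  code : node -> nat;
  order : nat;
  npar : nat -> nat;
  valid_top : valid top;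
  code_top : code top = 0;
  par_top : par top = top;
  code_lt : forall v, valid v -> code v < order;
  code_inj : forall u v, valid u -> valid v -> code u = code v -> u = v;
  decode : forall i, i < order -> {v | valid v & code v = i};
  valid_par : forall v, valid v -> valid (par v);
  npar_code : forall v, valid v -> npar (code v) = code (par v);
  ascend : forall v, valid v -> exists k, iter k par v = top
}.

Section TreeOf.
Variable P : presentation.
Implicit Types v u : node P.

Lemma order_gt0 : 0 < order P.
Proof. exact: leq_ltn_trans (code_lt (valid_top P)). Qed.

Definition vertex0 : 'I_(order P) := Ordinal order_gt0.

Definition vparent : {ffun 'I_(order P) -> 'I_(order P)} :=
  [ffun i : 'I_(order P) => insubd vertex0 (npar P i)].

Lemma npar_lt i : i < order P -> npar P i < order P.
Proof.
by move=> /decode[v Vv <-]; rewrite npar_code //; apply/code_lt/valid_par.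
Qed.

Lemma val_vparent i : val (vparent i) = npar P i.
Proof. by rewrite ffunE val_insubd npar_lt. Qed.

Lemma vparent0 : vparent vertex0 = vertex0.
Proof.
by apply: val_inj; rewrite val_vparent /= -(code_top P) npar_code ?valid_top // par_top.
Qed.

Lemma iter_vparent (i : 'I_(order P)) v k : valid v -> val i = code v ->
  valid (iter k (@par P) v) /\ val (iter k vparent i) = code (iter k (@par P) v).
Proof.
move=> Vv eqv; elim: k => //= k [Vk IH]; split; first exact: valid_par.
by rewrite val_vparent /= IH npar_code.
Qed.

Lemma vparent_ascend (i : 'I_(order P)) v k : valid v -> val i = code v ->
  iter k (@par P) v = top P -> iter k vparent i = vertex0.
Proof.
move=> Vv eqv eqk; apply: val_inj; rewrite (iter_vparent k Vv eqv).2 eqk.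
exact: code_top.
Qed.

Lemma vertex0_reachable i : fconnect vparent i vertex0.
Proof.
have [v Vv eqv] := decode (ltn_ord i); have [k eqk] := ascend Vv.
by rewrite -(vparent_ascend Vv (esym eqv) eqk) fconnect_iter.
Qed.

Definition tree_of : rtree := RTree vparent0 vertex0_reachable.

Lemma encode_tree_of :
  encode_tree tree_of = order P :: 0 :: [seq npar P i | i <- iota 0 (order P)].
Proof.
rewrite /encode_tree /=; congr [:: _, _ & _].
by rewrite -val_enum_ord -map_comp; apply: eq_map => i; exact: val_vparent.
Qed.

Lemma height_tree_of h :
  (forall v, valid v -> exists2 k, k <= h & iter k (@par P) v = top P) ->
  height tree_of <= h.
Proof.
move=> Hh; apply/bigmax_leqP => i _; rewrite /depth.
have [v Vv eqv] := decode (ltn_ord i); have [k lek eqk] := Hh v Vv.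
have := vparent_ascend Vv (esym eqv) eqk; rewrite -/(parent tree_of) => eqi.
apply: leq_trans lek; rewrite -[root tree_of]/vertex0 -eqi.
(* [findex_iter] applies only below the length of the orbit; beyond it, that length already bounds
   [findex]. *)
have [ltk|lek] := ltnP k (fingraph.order (parent tree_of) i).
  by rewrite findex_iter.
by apply: leq_trans lek; apply/ltnW/findex_max/fconnect_iter.
Qed.

Lemma child_tree_of (i j : 'I_(order P)) u v :
  valid u -> valid v -> val i = code u -> val j = code v ->
  @child tree_of i j <-> u <> top P /\ par u = v.
Proof.
move=> Vu Vv equ eqv; rewrite /child -!(inj_eq val_inj) /= val_vparent /=.
rewrite equ eqv npar_code // -(code_top P); split.
  move=> /andP[/eqP nu /eqP eqp]; split; first by move=> uT; rewrite uT in nu.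
  exact: code_inj (valid_par Vu) Vv eqp.
move=> [nu <-]; rewrite eqxx andbT; apply/eqP => eqc; apply: nu.
exact: code_inj Vu (valid_top P) eqc.
Qed.

(** A label below [d] that separates siblings injects the children of a vertex into ['I_d]. *)
Lemma nchildren_tree_of d (port : node P -> nat) :
  (forall v, valid v -> port v < d) ->
  (forall u v, valid u -> valid v -> u <> top P -> v <> top P ->
     par u = par v -> port u = port v -> u = v) ->
  forall i : 'I_(order P), @nchildren tree_of i <= d.
Proof.
move=> ltd inj i; have [w Vw eqw] := decode (ltn_ord i).
pose vx (c : 'I_(order P)) := s2val (decode (ltn_ord c)).
have Vvx c : valid (vx c) by rewrite /vx; case: decode.
have eqvx c : val c = code (vx c) by rewrite /vx; case: decode.
pose pt c : 'I_d := Ordinal (ltd _ (Vvx c)).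
rewrite /nchildren -(@card_in_image _ _ pt).
  by rewrite -[leqRHS]card_ord max_card.
move=> b c /(child_tree_of (Vvx b) Vw (eqvx b) (esym eqw))[nb eb].
move=> /(child_tree_of (Vvx c) Vw (eqvx c) (esym eqw))[nc ec] [eqp].
apply: val_inj; rewrite !eqvx; congr code.
by apply: inj => //; rewrite eb ec.
Qed.

End TreeOf.

Definition embedding (P Q : presentation) (f : node P -> node Q) : Prop :=
  [/\ forall v, valid v -> valid (f v),
      forall u v, valid u -> valid v -> f u = f v -> u = v,
      f (top P) = top Q
    & forall v, valid v -> v <> top P -> f v <> top Q /\ par (f v) = f (par v)].

Lemma iso_tree_of (P Q : presentation) :
  iso_to_subtree (tree_of P) (tree_of Q) <->
  exists f : node P -> node Q, embedding f.
Proof.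
pose vxP (c : 'I_(order P)) := s2val (decode (ltn_ord c)).
have VP c : valid (vxP c) by rewrite /vxP; case: decode.
have codeP c : val c = code (vxP c) by rewrite /vxP; case: decode.
pose vxQ (c : 'I_(order Q)) := s2val (decode (ltn_ord c)).
have VQ c : valid (vxQ c) by rewrite /vxQ; case: decode.
have codeQ c : val c = code (vxQ c) by rewrite /vxQ; case: decode.
split=> [[f [f_inj f_root f_child]]|[g [Vg g_inj g_top g_par]]].
- pose ord (v : node P) : 'I_(order P) := insubd (vertex0 P) (code v).
  have val_ord v : valid v -> val (ord v) = code v.
    by move=> Vv; rewrite val_insubd code_lt.
  have ord_top : ord (top P) = vertex0 P.
    by apply: val_inj; rewrite val_ord ?valid_top // code_top.
  have vx0 : vxQ (vertex0 Q) = top Q.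
    apply: code_inj (VQ _) (valid_top Q) _; rewrite -codeQ /=.
    by rewrite code_top.
  exists (fun v => vxQ (f (ord v))); split.
  + by move=> v _; exact: VQ.
  + move=> u v Vu Vv eq_uv; apply: code_inj => //.
    rewrite -!val_ord //; congr val; apply: f_inj; apply: val_inj.
    by rewrite !codeQ eq_uv.
  + by rewrite ord_top f_root.
  + move=> v Vv nv.
    have : @child (tree_of P) (ord v) (ord (par v)).
      apply/(child_tree_of Vv (valid_par Vv)); rewrite ?val_ord //.
      exact: valid_par.
    move=> /f_child.
    by move/(child_tree_of (VQ _) (VQ _) (codeQ _) (codeQ _)).
- pose ord (v : node Q) : 'I_(order Q) := insubd (vertex0 Q) (code v).
  have val_ord v : valid v -> val (ord v) = code v.
    by move=> Vv; rewrite val_insubd code_lt.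
  have vx0 : vxP (vertex0 P) = top P.
    apply: code_inj (VP _) (valid_top P) _; rewrite -codeP /=.
    by rewrite code_top.
  exists (fun i => ord (g (vxP i))); split.
  + move=> i j /(congr1 val); rewrite !val_ord ?Vg // => eq_ij.
    apply: val_inj; rewrite !codeP; congr code; apply: g_inj => //.
    by apply: code_inj eq_ij; exact: Vg.
  + rewrite [root _]/(vertex0 P) vx0 g_top; apply: val_inj.
    by rewrite val_ord ?valid_top //= code_top.
  + move=> c p /(child_tree_of (VP c) (VP p) (codeP c) (codeP p))[nc ec].
    have [ng eg] := g_par _ (VP c) nc.
    apply/(child_tree_of (Vg _ (VP c)) (Vg _ (VP p))); rewrite ?val_ord ?Vg //.
    by rewrite eg ec.
Qed.

(** * The trees of the reduction *)

Lemma mixed_radix_lt n g z G : g < G -> z < n -> g * n + z < G * n.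
Proof.
move=> ltg ltz; apply: (@leq_trans (g.+1 * n)); last by rewrite leq_mul2r ltg orbT.
by rewrite mulSn; lia.
Qed.

Lemma mixed_radix_inj n a b i j : i < n -> j < n ->
  a * n + i = b * n + j -> a = b /\ i = j.
Proof.
move=> lti ltj eq_n; have n_gt0 : 0 < n by lia.
split.
  by have := congr1 (divn^~ n) eq_n; rewrite !divnMDl // !divn_small // !addn0.
by have := congr1 (modn^~ n) eq_n; rewrite !modnMDl !modn_small.
Qed.

(* The number of vertices of depth less than [k] in the complete [d]-ary tree. *)
Fixpoint offset (d k : nat) : nat :=
  if k is k'.+1 then offset d k' * d + 1 else 0.

Arguments offset : simpl never.

Lemma offset0 d : offset d 0 = 0.
Proof. by []. Qed.

Lemma offset_rec d k : offset d k.+1 = offset d k * d + 1.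
Proof. by []. Qed.

Lemma offsetS d k : offset d k.+1 = offset d k + d ^ k.
Proof.
elim: k => [|k IH]; first by rewrite expn0.
by rewrite offset_rec {1}IH expnS offset_rec; lia.
Qed.

Lemma leq_offset d j k : j <= k -> offset d j <= offset d k.
Proof.
move=> /subnKC <-; elim: (k - j) => [|i IH]; first by rewrite addn0.
by rewrite addnS offsetS; lia.
Qed.

Lemma offset_inj d j k x y : x < d ^ j -> y < d ^ k ->
  offset d j + x = offset d k + y -> j = k /\ x = y.
Proof.
move=> ltx lty eq_off; have eq_jk : j = k.
  case: (ltngtP j k) => // lt; have := leq_offset d lt; rewrite offsetS; lia.
by split=> //; rewrite eq_jk in eq_off; lia.
Qed.

Lemma offset_decode d k i : i < offset d k ->
  {jx : nat * nat | [&& jx.1 < k & jx.2 < d ^ jx.1] & offset d jx.1 + jx.2 = i}.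
Proof.
elim: k => // k IH lti; have [lt|le] := ltnP i (offset d k).
  by have [jx /andP[lt1 lt2] <-] := IH lt; exists jx => //; rewrite lt2 andbT; lia.
exists (k, i - offset d k); rewrite /=; last lia.
by rewrite ltnSn; move: lti; rewrite offsetS; lia.
Qed.

(* The coordinates of a gadget are the leaves [Main (D + j)] of the binary heap
   with root [Main 1], below a stem [Main 0]; [Mid x] subdivides the edge from
   [Main x] to its parent, and [Leg y] hangs from [Mid (2 * y)] to tell the two
   children of a vertex apart.  At coordinate [j], [Pin j] is a child of the leaf,
   [Flip j] is a child of the leaf if the bit is set and of [Pin j] if not, and
   [Tail j], in the second tree only, is a child of [Pin j].  So a set bit embeds
   into set bits only, and a clear bit into anything. *)
Inductive slot :=
  | Main (x : nat)
  | Mid (x : nat)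
  | Leg (y : nat)
  | Pin (j : nat)
  | Flip (j : nat)
  | Tail (j : nat).

(* [Spec k x] is at depth [k + 1] of the complete tree below the last leaf, and
   [Path k i] at depth [k + 1] of the path below the leaf [i]. *)
Inductive vertex :=
  | Top (k x : nat)
  | Spec (k x : nat)
  | Path (k i : nat)
  | Gad (g : nat) (t : slot).

(* An automorphism of the complete [d]-ary tree, on level [k], that moves the
   vertex [b] of that level to the last position: a digitwise rotation. *)
Fixpoint twist (d k b x : nat) : nat :=
  if k is k'.+1 then
    twist d k' (b %/ d) (x %/ d) * d + (x %% d + (d - 1) + (d - b %% d)) %% d
  else x.

Lemma divn_modn_inj e x y : x %/ e = y %/ e -> x %% e = y %% e -> x = y.
Proof. by move=> eqd eqm; rewrite (divn_eq x e) (divn_eq y e) eqd eqm. Qed.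

Lemma twist_lt d k b x : 0 < d -> x < d ^ k -> twist d k b x < d ^ k.
Proof.
move=> d_gt0; elim: k b x => //= k IH b x ltx.
rewrite expnSr; apply: mixed_radix_lt; last by rewrite ltn_mod.
by apply: IH; rewrite ltn_divLR // -expnSr.
Qed.

Lemma twist_div d k b x : 0 < d ->
  twist d k.+1 b x %/ d = twist d k (b %/ d) (x %/ d).
Proof. by move=> d_gt0; rewrite /= divnMDl // [X in _ + X]divn_small ?addn0 // ltn_mod. Qed.

Lemma twist_inj d k b : 0 < d -> injective (twist d k b).
Proof.
move=> d_gt0; elim: k b => [|k IH] b x y //= eq_t.
have ltm z : z %% d < d by rewrite ltn_mod.
have [eqd eqm] := mixed_radix_inj (ltm _) (ltm _) eq_t.
apply: (divn_modn_inj (IH _ _ _ eqd)).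
move/eqP: eqm; rewrite !eqn_modDr => /eqP.
by rewrite !modn_mod.
Qed.

(** Each digit of [b] is rotated to [d - 1], and [d ^ k - 1] is the number whose [k] digits all
    equal [d - 1]. *)
Lemma twist_last d k b : 0 < d -> b < d ^ k -> twist d k b b = d ^ k - 1.
Proof.
move=> d_gt0; elim: k b => [|k IH] b ltb /=; first by case: b ltb.
rewrite IH ?ltn_divLR // -?expnSr //.
have ltm : b %% d < d by rewrite ltn_mod.
have -> : b %% d + (d - 1) + (d - b %% d) = d - 1 + 1 * d by lia.
rewrite [d - 1 + _]addnC modnMDl modn_small; last by lia.
have := expn_gt0 d k; rewrite d_gt0 expnSr /=.
by case: (d ^ k) => // n _; rewrite subn1 /= mulSn; lia.
Qed.

Arguments twist : simpl never.

(** [b %/ d ^ (l - k)] is the ancestor on level [k] of the leaf [b]. *)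
Lemma divn_expn_step d l k b : k < l ->
  b %/ d ^ (l - k.+1) %/ d = b %/ d ^ (l - k).
Proof. by move=> ltk; rewrite -divnMA -expnSr -subSn. Qed.

(** * Numbering, height and degree of both trees *)

Section Family.
Variables (d l D : nat) (sp : bool) (bit : nat -> nat -> bool).
Hypotheses (d_gt1 : 1 < d) (l_gt0 : 0 < l) (D_gt0 : 0 < D).

Local Notation N := (d ^ l).
Local Notation U := (offset d l.+1).
Definition npaths := N - sp.
Definition ngadgets := npaths + sp * N.
Definition path_base := U + sp * (U - 1).
Definition gadget_base := path_base + l * npaths.
Definition gadget_size := (7 + sp) * D.
Definition family_order := gadget_base + ngadgets * gadget_size.

Definition attach_num (g : nat) : nat :=
  if g < npaths then gadget_base - npaths + g else U - 1 + (U - N) + (g - npaths).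

Definition gadget_par (v g z : nat) : nat :=
  if z < 2 * D then v + 2 * D
  else if z == 2 * D then attach_num g
  else if z < 4 * D then v - z + (z - 2 * D) %/ 2
  else if z < 5 * D then v - z + 2 * D + 2 * (z - 4 * D)
  else if z < 6 * D then v - 4 * D
  else if z < 7 * D then if bit g (z - 6 * D) then v - 5 * D else v - D
  else v - 2 * D.

Definition family_par (v : nat) : nat :=
  if v < U then (v - 1) %/ d
  else if v < path_base then U - 1 + (v - U) %/ d
  else if v < path_base + npaths then v - path_base + (U - N)
  else if v < gadget_base then v - npaths
  else gadget_par v ((v - gadget_base) %/ gadget_size)
         ((v - gadget_base) %% gadget_size).

Definition slot_valid (t : slot) : bool :=
  match t with
  | Main x | Mid x => x < 2 * D
  | Leg y => y < D
  | Pin j | Flip j => j < D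
  | Tail j => sp && (j < D)
  end.

Definition slot_code (t : slot) : nat :=
  match t with
  | Main x => x
  | Mid x => 2 * D + x
  | Leg y => 4 * D + y
  | Pin j => 5 * D + j
  | Flip j => 6 * D + j
  | Tail j => 7 * D + j
  end.

Definition vertex_valid (v : vertex) : bool :=
  match v with
  | Top k x => (k <= l) && (x < d ^ k)
  | Spec k x => [&& sp, k < l & x < d ^ k.+1]
  | Path k i => (k < l) && (i < npaths)
  | Gad g t => (g < ngadgets) && slot_valid t
  end.

(** The second complete tree is numbered like the first, shifted by [U - 1], so that the last leaf
    acts as its root. Paths are stored level by level, so that the parent of a path vertex lies
    [npaths] before it. *)
Definition vertex_code (v : vertex) : nat :=
  match v with
  | Top k x => offset d k + x
  | Spec k x => U + (offset d k * d + x)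
  | Path k i => path_base + (k * npaths + i)
  | Gad g t => gadget_base + (g * gadget_size + slot_code t)
  end.

Definition attach (g : nat) : vertex :=
  if g < npaths then Path l.-1 g else Spec l.-1 (g - npaths).

Definition vertex_par (v : vertex) : vertex :=
  match v with
  | Top 0 _ => Top 0 0
  | Top k.+1 x => Top k (x %/ d)
  | Spec 0 x => Top l (N - 1)
  | Spec k.+1 x => Spec k (x %/ d)
  | Path 0 i => Top l i
  | Path k.+1 i => Path k i
  | Gad g (Main x) => Gad g (Mid x)
  | Gad g (Mid x) => if x == 0 then attach g else Gad g (Main (x %/ 2))
  | Gad g (Leg y) => Gad g (Mid (2 * y))
  | Gad g (Pin j) => Gad g (Main (D + j))
  | Gad g (Flip j) => if bit g j then Gad g (Main (D + j)) else Gad g (Pin j)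
  | Gad g (Tail j) => Gad g (Pin j)
  end.

Let N_gt1 : 1 < N.
Proof. by rewrite -(expn0 d) ltn_exp2l. Qed.

Let U_eq : U = offset d l + N.
Proof. exact: offsetS. Qed.

Lemma slot_code_lt t : slot_valid t -> slot_code t < gadget_size.
Proof. by rewrite /gadget_size; case: t => /= j; case: sp => /=; nia. Qed.

Lemma slot_code_inj t u : slot_valid t -> slot_valid u ->
  slot_code t = slot_code u -> t = u.
Proof.
by case: t => x; case: u => y /=; case: sp => //= *; (congr (_ _); lia) || lia.
Qed.

Lemma slot_decode z : z < gadget_size -> {t | slot_valid t & slot_code t = z}.
Proof.
rewrite /gadget_size => ltz.
have [lt2|le2] := ltnP z (2 * D); first by exists (Main z) => //=; lia.
have [lt4|le4] := ltnP z (4 * D); first by exists (Mid (z - 2 * D)) => /=; lia.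
have [lt5|le5] := ltnP z (5 * D); first by exists (Leg (z - 4 * D)) => /=; lia.
have [lt6|le6] := ltnP z (6 * D); first by exists (Pin (z - 5 * D)) => /=; lia.
have [lt7|le7] := ltnP z (7 * D); first by exists (Flip (z - 6 * D)) => /=; lia.
by exists (Tail (z - 7 * D)) => /=; move: ltz; case: sp => /=; lia.
Qed.

Lemma level_lt k x : k <= l -> x < d ^ k -> offset d k + x < U.
Proof.
by move=> lek ltx; have := @leq_offset d k.+1 l.+1 lek; rewrite offsetS; lia.
Qed.

Lemma spec_lt k x : k < l -> x < d ^ k.+1 -> offset d k * d + x + 1 < U.
Proof. by move=> ltk ltx; have := level_lt ltk ltx; rewrite offset_rec; lia. Qed.

Lemma path_lt k i : k < l -> i < npaths -> k * npaths + i < l * npaths.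
Proof. exact: mixed_radix_lt. Qed.

Lemma vertex_code_lt v : vertex_valid v -> vertex_code v < family_order.
Proof.
rewrite /family_order.
case: v => [k x|k x|k i|g t] /=; rewrite /gadget_base /path_base.
- by move=> /andP[lek ltx]; have := level_lt lek ltx; rewrite /=; lia.
- move=> /and3P[-> ltk ltx]; have := spec_lt ltk ltx; rewrite /=; lia.
- by move=> /andP[ltk lti]; have := path_lt ltk lti; lia.
- move=> /andP[ltg /slot_code_lt ltt].
  by have := mixed_radix_lt ltg ltt; lia.
Qed.

Lemma vertex_code_section v : vertex_valid v ->
  match v with
  | Top _ _ => vertex_code v < U
  | Spec _ _ => U <= vertex_code v < path_base
  | Path _ _ => path_base <= vertex_code v < gadget_base
  | Gad _ _ => gadget_base <= vertex_code v
  end.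
Proof.
case: v => [k x|k x|k i|g t] /=; rewrite /gadget_base /path_base.
- by move=> /andP[lek ltx]; have := level_lt lek ltx.
- by move=> /and3P[-> ltk ltx]; have := spec_lt ltk ltx; rewrite /=; lia.
- by move=> /andP[ltk lti]; have := path_lt ltk lti; lia.
- by lia.
Qed.

Lemma sections : U <= path_base <= gadget_base.
Proof. by rewrite /gadget_base /path_base; lia. Qed.

Lemma vertex_code_inj u v : vertex_valid u -> vertex_valid v ->
  vertex_code u = vertex_code v -> u = v.
Proof.
move=> Vu Vv; have := vertex_code_section Vu; have := vertex_code_section Vv.
have := sections.
case: u Vu => [k x|k x|k i|g t]; case: v Vv => [k' x'|k' x'|k' i'|g' t'] Vv Vu
  sec secv secu eqc; try lia; move: Vu Vv eqc {sec secv secu} => /=.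
- by move=> /andP[_ ltx] /andP[_ ltx'] /(offset_inj ltx ltx')[-> ->].
- move=> /and3P[_ _ ltx] /and3P[_ _ ltx'] eqc.
  suff [[-> ->]] : k.+1 = k'.+1 /\ x = x' by [].
  by apply: offset_inj ltx ltx' _; rewrite !offset_rec; lia.
- move=> /andP[_ lti] /andP[_ lti'] /addnI.
  by move=> /(mixed_radix_inj lti lti')[-> ->].
- move=> /andP[_ Vt] /andP[_ Vt'] /addnI.
  move=> /(mixed_radix_inj (slot_code_lt Vt) (slot_code_lt Vt'))[-> eqt].
  by rewrite (slot_code_inj Vt Vt' eqt).
Qed.

Lemma vertex_decode i : i < family_order ->
  {v | vertex_valid v & vertex_code v = i}.
Proof.
move=> lti; have [ltU|leU] := ltnP i U.
  by have [[k x] /= /andP[ltk ltx] <-] := offset_decode ltU; exists (Top k x) => //=; lia.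
have [ltp|lep] := ltnP i path_base.
  have sp1 : sp = true by move: ltp; rewrite /path_base; case: sp => //=; lia.
  have lt' : i - (U - 1) < U by move: ltp; rewrite /path_base; case: sp => /=; lia.
  have [[k x] /= /andP[ltk ltx] eqi] := offset_decode lt'.
  case: k ltk ltx eqi => [|k] ltk ltx eqi.
    by move: eqi ltx; rewrite expn0 offset0; lia.
  by exists (Spec k x) => /=; [rewrite sp1; lia | rewrite offset_rec in eqi; lia].
have [ltg|leg] := ltnP i gadget_base.
  have Np_gt0 : 0 < npaths by rewrite /npaths; case: sp; lia.
  exists (Path ((i - path_base) %/ npaths) ((i - path_base) %% npaths)) => /=.
    rewrite ltn_mod Np_gt0 andbT ltn_divLR //.
    by move: ltg; rewrite /gadget_base; lia.
  by rewrite -divn_eq; lia.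
have Z_gt0 : 0 < gadget_size by rewrite /gadget_size muln_gt0; lia.
have [|t Vt eqt] := @slot_decode ((i - gadget_base) %% gadget_size).
  by rewrite ltn_mod.
exists (Gad ((i - gadget_base) %/ gadget_size) t) => /=.
  by rewrite Vt andbT ltn_divLR //; move: lti; rewrite /family_order; lia.
by rewrite eqt -divn_eq; lia.
Qed.

Lemma attach_valid g : g < ngadgets -> vertex_valid (attach g).
Proof.
rewrite /attach /ngadgets; case: (ltnP g npaths) => leg ltg /=; first by lia.
by rewrite prednK //; move: leg ltg; rewrite /npaths; case: sp; rewrite /=; lia.
Qed.

Lemma vertex_par_valid v : vertex_valid v -> vertex_valid (vertex_par v).
Proof.
case: v => [[|k] x|[|k] x|[|k] i|g [x|x|y|j|j|j]] /=.
- by rewrite expn0.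
- by rewrite expnS => /andP[ltk ltx]; rewrite ltn_divLR 1?mulnC ?ltx; lia.
- by move=> _; rewrite leqnn; lia.
- rewrite (expnS d k.+1) => /and3P[-> ltk ltx].
  by rewrite ltn_divLR 1?mulnC ?ltx; lia.
- by rewrite /npaths leqnn; lia.
- by lia.
- by [].
- move=> /andP[ltg ltx]; case: eqP => [_|nx]; first exact: attach_valid.
  by rewrite /= ltg; lia.
- by move=> /andP[-> lty]; lia.
- by move=> /andP[-> ltj]; lia.
- by move=> /andP[ltg ltj]; case: bit; rewrite /= ltg; lia.
- by case/and3P => [-> _ ->].
Qed.

Lemma attach_code g : g < ngadgets -> vertex_code (attach g) = attach_num g.
Proof.
rewrite /attach /attach_num; case: (ltnP g npaths) => leg ltg /=.
  rewrite /gadget_base -{2}(prednK l_gt0) mulSn.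
  by move: (l.-1 * _) => a; lia.
have eq_off : offset d l = offset d l.-1 * d + 1 by rewrite -offset_rec prednK.
by have := U_eq; lia.
Qed.

Lemma family_par_gadget g t : g < ngadgets -> slot_valid t ->
  family_par (vertex_code (Gad g t)) =
  gadget_par (vertex_code (Gad g t)) g (slot_code t).
Proof.
move=> ltg Vt; have Vv : vertex_valid (Gad g t) by rewrite /= ltg.
rewrite /family_par; have := vertex_code_section Vv.
set c := vertex_code _ => sec; have := sections => secs.
have -> : c < U = false by lia.
have -> : c < path_base = false by lia.
have -> : c < gadget_base = false by lia.
have -> : c < path_base + npaths = false.
  suff : path_base + npaths <= gadget_base by lia.
  by rewrite /gadget_base leq_add2l leq_pmull.
have -> : c - gadget_base = g * gadget_size + slot_code t by rewrite /c /=; lia.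
have ltt := slot_code_lt Vt; have Z_gt0 : 0 < gadget_size by lia.
by rewrite divnMDl // modnMDl divn_small // modn_small // addn0.
Qed.

Lemma family_par_code v : vertex_valid v ->
  family_par (vertex_code v) = vertex_code (vertex_par v).
Proof.
move=> Vv; have := vertex_code_section Vv; have := sections.
case: v Vv => [k x|k x|k i|g t].
- rewrite /family_par => /andP[lek ltx] _ ->.
  case: k lek ltx => [|k] lek /=.
    by rewrite expn0; case: x => //; rewrite offset0 div0n.
  move=> _; have -> : offset d k.+1 + x - 1 = offset d k * d + x by rewrite offset_rec; lia.
  by rewrite divnMDl //; lia.
- rewrite /family_par => /and3P[sp1 ltk ltx] _ /andP[leU ->].
  rewrite ltnNge leU /=.
  have -> : U + (offset d k * d + x) - U = offset d k * d + x by lia.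
  have d_gt0 : 0 < d by lia.
  rewrite divnMDl //; case: k ltk ltx leU => [|k] ltk ltx leU /=.
    rewrite divn_small ?addn0 ?subn1; last by rewrite -(expn1 d).
    by have := U_eq; rewrite ?offset0; lia.
  by have := U_eq; rewrite (offset_rec d k); lia.
- rewrite /family_par => /andP[ltk lti] secs /andP[lep ltg].
  set c := vertex_code _ in lep ltg *.
  have -> : c < U = false by lia.
  have -> : c < path_base = false by lia.
  rewrite ltg; rewrite {}/c in lep ltg *.
  case: k ltk lep ltg => [|k] ltk lep ltg /=.
    rewrite mul0n add0n ltn_add2l lti.
    by have := U_eq; lia.
  rewrite mulSn.
  have -> : path_base + (npaths + k * npaths + i) < path_base + npaths = false by lia.
  by lia.
- move=> /andP[ltg Vt] _ _; rewrite family_par_gadget //.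
  rewrite /gadget_par; case: t Vt => [x|x|y|j|j|j] /= Vt.
  + by rewrite Vt; lia.
  + have -> : 2 * D + x < 2 * D = false by lia.
    rewrite -[X in _ == X]addn0 eqn_add2l; case: eqP => [_|nx].
      by rewrite attach_code.
    have -> : 2 * D + x < 4 * D by lia.
    rewrite /= addKn; lia.
  + have -> : 4 * D + y < 2 * D = false by lia.
    have -> : 4 * D + y == 2 * D = false by lia.
    have -> : 4 * D + y < 4 * D = false by lia.
    have -> : 4 * D + y < 5 * D by lia.
    by lia.
  + have -> : 5 * D + j < 2 * D = false by lia.
    have -> : 5 * D + j == 2 * D = false by lia.
    have -> : 5 * D + j < 4 * D = false by lia.
    have -> : 5 * D + j < 5 * D = false by lia.
    have -> : 5 * D + j < 6 * D by lia.
    by lia.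
  + have -> : 6 * D + j < 2 * D = false by lia.
    have -> : 6 * D + j == 2 * D = false by lia.
    have -> : 6 * D + j < 4 * D = false by lia.
    have -> : 6 * D + j < 5 * D = false by lia.
    have -> : 6 * D + j < 6 * D = false by lia.
    have -> : 6 * D + j < 7 * D by lia.
    have -> : 6 * D + j - 6 * D = j by lia.
    by case: bit => /=; lia.
  + have -> : 7 * D + j < 2 * D = false by lia.
    have -> : 7 * D + j == 2 * D = false by lia.
    have -> : 7 * D + j < 4 * D = false by lia.
    have -> : 7 * D + j < 5 * D = false by lia.
    have -> : 7 * D + j < 6 * D = false by lia.
    have -> : 7 * D + j < 7 * D = false by lia.
    by lia.
Qed.

Definition within (h : nat) (v : vertex) : Prop :=
  exists2 k, k <= h & iter k vertex_par v = Top 0 0.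

Lemma within_par h v : within h (vertex_par v) -> within h.+1 v.
Proof. by move=> [k lek eqk]; exists k.+1; rewrite ?ltnS // iterSr. Qed.

Lemma within_leq h h' v : h <= h' -> within h v -> within h' v.
Proof. by move=> le_h [k lek eqk]; exists k => //; exact: leq_trans le_h. Qed.

Lemma within_top k x : x < d ^ k -> within k (Top k x).
Proof.
elim: k x => [|k IH] x; first by rewrite expn0; case: x => // _; exists 0.
rewrite expnS => ltx; apply/within_par/IH.
by rewrite ltn_divLR 1?mulnC; lia.
Qed.

Lemma within_spec k x : k < l -> x < d ^ k.+1 -> within (l + k.+1) (Spec k x).
Proof.
elim: k x => [|k IH] x ltk ltx; rewrite addnS; apply: within_par.
  by rewrite addn0; apply: within_top; lia.
by apply: IH; [lia | rewrite ltn_divLR 1?mulnC -?expnS; lia].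
Qed.

Lemma within_path k i : k < l -> i < npaths -> within (l + k.+1) (Path k i).
Proof.
elim: k => [|k IH] ltk lti; rewrite addnS; apply: within_par.
  by rewrite addn0; apply: within_top; move: lti; rewrite /npaths; lia.
by apply: IH; lia.
Qed.

Lemma within_attach g : g < ngadgets -> within (2 * l) (attach g).
Proof.
move=> /attach_valid; rewrite /attach; case: ifP => _ /= V.
  by have := @within_path l.-1 g; rewrite prednK // addnn -mul2n; apply; lia.
have := @within_spec l.-1 (g - npaths).
by rewrite prednK // addnn -mul2n; rewrite prednK // in V; apply; lia.
Qed.

(** One halving of [x] climbs two edges, from [Mid] to [Main] and on to [Mid]. *)
Lemma within_mid i g x : g < ngadgets -> x < 2 ^ i ->
  within (2 * l + 2 * i + 1) (Gad g (Mid x)).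
Proof.
move=> ltg; elim: i x => [|i IH] x ltx; rewrite addn1; apply: within_par.
  by rewrite expn0 in ltx; case: x ltx => // _; rewrite muln0 addn0; exact: within_attach.
rewrite /=; case: eqP => [_|nx].
  by apply: within_leq (within_attach ltg); lia.
rewrite mulnS addnCA add2n; apply: within_par => /=.
rewrite -addn1; apply: IH.
by rewrite ltn_divLR // mulnC -expnS.
Qed.

(** As [2 * D <= 2 ^ (L + 1)], a [Mid] vertex lies at most [2 * (L + 1) + 1] edges below its
    attachment at depth [2 * l]; [Main], [Pin], and [Flip] or [Tail] add one edge each. *)
Lemma ascend_family L v : D <= 2 ^ L -> vertex_valid v ->
  within (2 * l + 2 * L + 6) v.
Proof.
move=> leD; case: v => [k x|k x|k i|g t] /=.
- by move=> /andP[lek ltx]; apply: within_leq (within_top ltx); lia.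
- by move=> /and3P[_ ltk ltx]; apply: within_leq (within_spec ltk ltx); lia.
- by move=> /andP[ltk lti]; apply: within_leq (within_path ltk lti); lia.
move=> /andP[ltg Vt].
have mid x : x < 2 * D -> within (2 * l + 2 * L + 3) (Gad g (Mid x)).
  move=> ltx; have ltx' : x < 2 ^ L.+1 by rewrite expnS; lia.
  by apply: within_leq (within_mid ltg ltx'); lia.
have main x : x < 2 * D -> within (2 * l + 2 * L + 4) (Gad g (Main x)).
  by move=> ltx; rewrite addnS; apply/within_par/mid.
have pin j : j < D -> within (2 * l + 2 * L + 5) (Gad g (Pin j)).
  by move=> ltj; rewrite addnS; apply/within_par/main; lia.
case: t Vt => [x|x|y|j|j|j] /= Vt.
- by apply: within_leq (main _ Vt); lia.
- by apply: within_leq (mid _ Vt); lia.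
- by rewrite addnS; apply/within_par/(within_leq _ (mid _ _)); lia.
- by apply: within_leq (pin _ Vt); lia.
- rewrite addnS; apply/within_par => /=; case: bit.
    by apply: within_leq (main _ _); lia.
  exact: pin.
- by rewrite addnS; apply/within_par/pin; lia.
Qed.

Lemma family_ascend v : vertex_valid v -> exists k, iter k vertex_par v = Top 0 0.
Proof.
move=> /(@ascend_family D); case=> [|k _ eqk]; first exact/ltnW/ltn_expl.
by exists k.
Qed.

Definition tree_family : presentation :=
  @Presentation vertex vertex_valid vertex_par (Top 0 0) vertex_code family_order
    family_par isT erefl erefl vertex_code_lt vertex_code_inj vertex_decode
    vertex_par_valid family_par_code family_ascend.

(** The label for [nchildren_tree_of]. Gadgets branch in two at most, so 0 and 1 are enough in
    them. *)
Definition port (v : vertex) : nat :=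
  match v with
  | Top _ x | Spec _ x => x %% d
  | Path _ _ => 0
  | Gad _ (Main _) => 0
  | Gad _ (Mid x) => x %% 2
  | Gad _ (Leg _) => 1
  | Gad _ (Pin _) => 0
  | Gad g (Flip j) => if bit g j then 1 else 0
  | Gad _ (Tail _) => 1
  end.

Lemma port_lt v : port v < d.
Proof.
have d_gt0 : 0 < d by lia.
case: v => [k x|k x|k i|g [x|x|y|j|j|j]] /=; rewrite ?ltn_mod //.
- by apply: leq_trans d_gt1; rewrite ltnS -ltnS ltn_mod.
- by case: bit.
Qed.

Lemma port_inj u v : vertex_valid u -> vertex_valid v ->
  u <> Top 0 0 -> v <> Top 0 0 ->
  vertex_par u = vertex_par v -> port u = port v -> u = v.
Proof.
(* In the second tree no path starts at the last leaf, so a [Path] and a [Spec] vertex are never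
   siblings. *)
have Npl : sp -> npaths = N - 1 by rewrite /npaths => ->.
case: u => [[|k] x|[|k] x|[|k] i|g [x|x|y|j|j|j]];
case: v => [[|k'] x'|[|k'] x'|[|k'] i'|g' [x'|x'|y'|j'|j'|j']];
rewrite /= ?expn0 => Vu Vv nu nv;
rewrite /attach; repeat case: ifP => ?; move=> //.
all: try (by case: x Vu nu => [|x]).
all: try (by case: x' Vv nv => [|x']).
all: move=> eqp eqm; try (injection eqp; intros); subst; move=> //; try (exfalso; lia).
all: try by congr (_ _); apply: divn_modn_inj eqm.
all: try by (repeat f_equal; lia).
all: try by (have := Npl; lia).
move: eqm; rewrite expn1 in Vu Vv.
by rewrite !modn_small => [->| |] //; lia.
Qed.

End Family.

(** * Embeddings and orthogonal pairs *)

Section Orthogonality.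
Variables (d l D : nat) (bh bg : nat -> nat -> bool).
Hypotheses (d_gt1 : 1 < d) (l_gt0 : 0 < l) (D_gt0 : 0 < D).
Local Notation N := (d ^ l).
Local Notation H := (tree_family false bh d_gt1 l_gt0 D_gt0).
Local Notation G := (tree_family true bg d_gt1 l_gt0 D_gt0).
Hypothesis bg_universal : forall g j, g < N - 1 -> bg g j.

Let N_gt1 : 1 < N.
Proof. by rewrite -(expn0 d) ltn_exp2l. Qed.

Section Rigidity.
Variable f : vertex -> vertex.
Hypothesis f_emb : @embedding H G f.

Lemma embedding_child u v : vertex_valid d l D false u -> u <> Top 0 0 ->
  f (vertex_par d l D false bh u) = v ->
  [/\ vertex_valid d l D true (f u), f u <> Top 0 0
    & vertex_par d l D true bg (f u) = v].
Proof.
move: f_emb => [Vf _ _ f_par] Vu nu <-.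
by have [nf ef] := f_par u Vu nu; split=> //; exact: Vf.
Qed.

Lemma embedding_neq u v : vertex_valid d l D false u -> vertex_valid d l D false v ->
  u <> v -> f u <> f v.
Proof. by move: f_emb => [_ f_inj _ _] Vu Vv nuv /(f_inj _ _ Vu Vv). Qed.

(** Above level [l], the children in [G] of a vertex of the complete tree lie on the next level of
    that tree. *)
Lemma embedding_top k x : k <= l -> x < d ^ k ->
  exists2 y, y < d ^ k & f (Top k x) = Top k y.
Proof.
elim: k x => [|k IH] x lek ltx.
  rewrite expn0 in ltx; exists 0 => //; rewrite -[x]/(x : nat).
  by case: x ltx => // _; case: f_emb.
have [|y lty fy] := IH (x %/ d) (ltnW lek).
  by rewrite ltn_divLR 1?mulnC -?expnS; lia.
have [|//|] := @embedding_child (Top k.+1 x) (Top k y) _ _ fy.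
  by rewrite /= lek ltx.
case: (f _) => [[|k'] x'|[|k'] x'|[|k'] i'|g' [x'|x'|y'|j'|j'|j']] //=.
- by rewrite expn0 => ltx' nt; case: nt; congr Top; lia.
- by move=> /andP[_ ltx'] _ [<- _]; exists x'.
- by move=> _ _ [? _]; lia.
- by move=> _ _ [? _]; lia.
- by case: eqP => // _; rewrite /attach; case: ifP.
- by case: bg.
Qed.

(** By counting: [f] maps the [N] leaves of level [l] injectively into themselves, hence onto. *)
Lemma special_leaf : exists2 b, b < N & f (Top l b) = Top l (N - 1).
Proof.
have N_gt0 : 0 < N by lia.
pose index v := if v is Top _ y then y else 0.
pose h (b : 'I_N) : 'I_N := insubd (Ordinal N_gt0) (index (f (Top l b))).
have hE b : f (Top l (val b)) = Top l (val (h b)).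
  have [y lty eqf] := embedding_top (leqnn l) (ltn_ord b).
  by rewrite val_insubd eqf /= lty.
have h_inj : injective h.
  move=> b b' eqh; apply: val_inj; apply/eqP/negPn/negP => /eqP nb.
  apply: (@embedding_neq (Top l b) (Top l b')); rewrite /= ?leqnn ?ltn_ord //.
    by case.
  by rewrite !hE eqh.
have lt1 : N - 1 < N by lia.
have /codomP[b eqb] := injF_onto h_inj (Ordinal lt1).
by exists b => //; rewrite hE -eqb.
Qed.

(** All children of the last leaf of [G] are [Spec] vertices, so the path below [b] can only descend
    into the second complete tree. *)
Lemma special_path b k : b < N -> f (Top l b) = Top l (N - 1) -> k < l ->
  exists2 x, x < d ^ k.+1 & f (Path k b) = Spec k x.
Proof.
move=> ltb eqb; have Nt : npaths d l false = N by rewrite /npaths subn0.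
elim: k => [|k IH] ltk.
  have [|//|] := @embedding_child (Path 0 b) (Top l (N - 1)) _ _ eqb.
    by rewrite /= ltk Nt.
  case: (f _) => [[|k'] x'|[|k'] x'|[|k'] i'|g' [x'|x'|y'|j'|j'|j']] //=.
  - by move=> _ nt [? _]; lia.
  - by move=> /andP[? _] _ [? _]; lia.
  - by move=> /andP[_ ?] _ _; exists x'.
  - by rewrite /npaths => /andP[_ ?] _ [?]; lia.
  - by case: eqP => // _; rewrite /attach; case: ifP.
  - by case: bg.
have [x ltx eqx] := IH (ltnW ltk).
have [|//|] := @embedding_child (Path k.+1 b) (Spec k x) _ _ eqx.
  by rewrite /= ltk Nt.
case: (f _) => [[|k'] x'|[|k'] x'|[|k'] i'|g' [x'|x'|y'|j'|j'|j']] //=.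
- by move=> /andP[_ ?] _ [<- _]; exists x'.
- move=> _ _; case: eqP => // _; rewrite /attach; case: ifP => // _ [? _]; lia.
- by case: bg.
Qed.

Lemma special_gadget b : b < N -> f (Top l b) = Top l (N - 1) ->
  exists2 a, a < N & f (Gad b (Mid 0)) = Gad (N - 1 + a) (Mid 0).
Proof.
move=> ltb eqb; have Nt : npaths d l false = N by rewrite /npaths subn0.
have ltl : l.-1 < l by lia.
have [a lta eqa] := special_path ltb eqb ltl.
rewrite prednK // in lta; exists a => //.
have [|//||] := @embedding_child (Gad b (Mid 0)) (Spec l.-1 a).
- by rewrite /= /ngadgets Nt; lia.
- by rewrite /= /attach Nt ltb.
case: (f _) => [[|k'] x'|[|k'] x'|[|k'] i'|g' [x'|x'|y'|j'|j'|j']] //=.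
- by move=> ? _ [? _]; lia.
- move=> _ _; case: eqP => [->|//]; rewrite /attach; case: ifP => // leg [<-].
  by congr Gad; rewrite /npaths /= in leg *; lia.
- by case: bg.
Qed.

Section Gadget.
Variables b c : nat.
Hypothesis b_lt : b < ngadgets d l false.

Lemma gadget_child t v u : slot_valid D false t ->
  f v = u -> vertex_par d l D false bh (Gad b t) = v ->
  [/\ vertex_valid d l D true (f (Gad b t)), f (Gad b t) <> Top 0 0
    & vertex_par d l D true bg (f (Gad b t)) = u].
Proof.
move=> Vt eqf eqv; apply: embedding_child => //; first by rewrite /= b_lt.
by rewrite eqv.
Qed.

Lemma gadget_neq t u : slot_valid D false t -> slot_valid D false u -> t <> u ->
  f (Gad b t) <> f (Gad b u).
Proof. by move=> Vt Vu ntu; apply: embedding_neq; rewrite /= ?b_lt // => -[]. Qed.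

(* [Main x] has a child and [Leg] does not. *)
Lemma main_fixed x : x < 2 * D ->
  f (Gad b (Mid x)) = Gad c (Mid x) -> f (Gad b (Main x)) = Gad c (Main x).
Proof.
move=> ltx eqm.
have [V _] := @gadget_child (Main x) _ _ ltx eqm erefl.
case eqf: (f (Gad b (Main x))) V
  => [[|k'] x'|[|k'] x'|[|k'] i'|g' [x'|x'|y'|j'|j'|j']] //= V.
- by case=> <- <-.
- by case: eqP => // _; rewrite /attach; case: ifP.
- move=> _; have [t Vt eqt] : exists2 t, slot_valid D false t &
      vertex_par d l D false bh (Gad b t) = Gad b (Main x).
    have [ltD|leD] := ltnP x D; last first.
      by exists (Pin (x - D)) => /=; [lia | congr (Gad _ (Main _)); lia].
    (* [Mid 0] is the parent of [Main 0], whose child is therefore [Mid 1]. *)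
    case: x ltx ltD eqm eqf => [|x] ltx ltD eqm eqf.
      by exists (Mid 1) => //=; lia.
    exists (Mid (2 * x.+1)) => /=; first by lia.
    by rewrite mulKn.
  have [_ _] := gadget_child Vt eqf eqt.
  case: (f _) => [[|k0] x0|[|k0] x0|[|k0] i0|g0 [x0|x0|y0|j0|j0|j0]] //=.
    by case: eqP => // _; rewrite /attach; case: ifP.
  by case: bg.
- by case: bg V.
Qed.

Lemma mid_child x y : 0 < x < 2 * D ->
  f (Gad b (Main (x %/ 2))) = Gad c (Main y) -> y < D ->
  exists2 z, 0 < z < 2 * D & f (Gad b (Mid x)) = Gad c (Mid z) /\ z %/ 2 = y.
Proof.
move=> /andP[x_gt0 ltx] eqm lty.
have eqp : vertex_par d l D false bh (Gad b (Mid x)) = Gad b (Main (x %/ 2)).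
  by rewrite /= gtn_eqF.
have [V _] := @gadget_child (Mid x) _ _ ltx eqm eqp.
case: (f _) V => [[|k0] x0|[|k0] x0|[|k0] i0|g0 [x0|x0|y0|j0|j0|j0]] //= V.
- case: eqP => [_|nx]; first by rewrite /attach; case: ifP.
  by case=> <- <-; exists x0 => //; move: V; lia.
- by case=> _ ?; lia.
- by case: bg => // -[_ ?]; lia.
Qed.

(* An even [Mid] has a [Leg] next to its [Main], an odd one does not; so the two
   children of a [Main] vertex cannot be exchanged. *)
Lemma mid_even_fixed x : 0 < x < D ->
  f (Gad b (Main x)) = Gad c (Main x) ->
  f (Gad b (Mid (2 * x))) = Gad c (Mid (2 * x)).
Proof.
move=> /andP[x_gt0 ltx] eqm.
have lt2x : 0 < 2 * x < 2 * D by lia.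
have eqm2 : f (Gad b (Main (2 * x %/ 2))) = Gad c (Main x) by rewrite mulKn.
have [z ltz [eqz ez]] := mid_child lt2x eqm2 ltx.
have zE : z = 2 * x \/ z = (2 * x).+1 by lia.
case: zE => [zE|zE]; [by rewrite eqz zE | exfalso].
have Vm : slot_valid D false (Main (2 * x)) by rewrite /=; lia.
have Vl : slot_valid D false (Leg x) by [].
have child_of_odd t : slot_valid D false t ->
    vertex_par d l D false bh (Gad b t) = Gad b (Mid (2 * x)) ->
    f (Gad b t) = Gad c (Main z).
  move=> Vt eqt; have [V _] := gadget_child Vt eqz eqt.
  case: (f _) V => [[|k0] x0|[|k0] x0|[|k0] i0|g0 [x0|x0|y0|j0|j0|j0]] //= V.
  - by case=> -> ->.
  - by case: eqP => // _; rewrite /attach; case: ifP.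
  - by case=> _ ?; lia.
  - by case: bg.
apply: (gadget_neq Vm Vl) => //.
by rewrite !child_of_odd.
Qed.

(** Going down the heap, [mid_even_fixed] settles an even child, and injectivity then leaves only
    its own place to the odd sibling. [Main 0] has the single child [Mid 1], so no exchange is
    possible there. *)
Lemma gadget_rigid x : f (Gad b (Mid 0)) = Gad c (Mid 0) -> x < 2 * D ->
  f (Gad b (Mid x)) = Gad c (Mid x).
Proof.
move=> eq0; elim/ltn_ind: x => x IH ltx.
case: (posnP x) => [-> //|x_gt0].
have lt2 : x %/ 2 < x by lia.
have lth : x %/ 2 < D by lia.
have eqm : f (Gad b (Main (x %/ 2))) = Gad c (Main (x %/ 2)).
  by apply: main_fixed; [lia | apply: IH => //; lia].
have ltx0 : 0 < x < 2 * D by rewrite x_gt0.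
have [z ltz [eqz ez]] := mid_child ltx0 eqm lth.
rewrite eqz; congr (Gad _ (Mid _)).
case: (ltngtP x 1) => [?|x_gt1|?]; [lia | | lia].
have lt0h : 0 < x %/ 2 < D by lia.
have eq2 := mid_even_fixed lt0h eqm.
have xE : x = 2 * (x %/ 2) \/ x = (2 * (x %/ 2)).+1 by lia.
case: xE => [xE|xE]; first by move: eqz; rewrite xE eq2 => -[->].
have : z <> 2 * (x %/ 2) => [zE|]; last by lia.
apply: (@gadget_neq (Mid x) (Mid (2 * (x %/ 2)))); rewrite /=; try lia.
  by case; lia.
by rewrite eqz zE -eq2.
Qed.

(** A set bit gives the leaf of coordinate [j] the two children [Pin] and [Flip]; with the bit of
    [c] clear, its image would have [Pin] alone to receive both. *)
Lemma gadget_orthogonal j : f (Gad b (Mid 0)) = Gad c (Mid 0) -> j < D ->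
  bh b j -> bg c j.
Proof.
move=> eq0 ltj bhj; apply/negPn/negP => nbg.
have ltx : D + j < 2 * D by lia.
have eqm := main_fixed ltx (gadget_rigid eq0 ltx).
have child_pin t : slot_valid D false t ->
    vertex_par d l D false bh (Gad b t) = Gad b (Main (D + j)) ->
    f (Gad b t) = Gad c (Pin j).
  move=> Vt eqt; have [V _] := gadget_child Vt eqm eqt.
  case: (f _) V => [[|k0] x0|[|k0] x0|[|k0] i0|g0 [x0|x0|y0|j0|j0|j0]] //= V.
  - case: eqP => [_|_]; first by rewrite /attach; case: ifP.
    by case=> _ ?; lia.
  - by case=> -> /addnI->.
  - case: ifP => // bj [eg /addnI ej].
    by rewrite eg ej (negbTE nbg) in bj.
apply: (@gadget_neq (Pin j) (Flip j)) => //.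
by rewrite !child_pin //= bhj.
Qed.

End Gadget.

End Rigidity.

Lemma embedding_orthogonal : (exists f, @embedding H G f) ->
  exists b a, [/\ b < N, a < N & forall j, j < D -> bh b j -> bg (N - 1 + a) j].
Proof.
move=> [f f_emb]; have [b ltb eqb] := special_leaf f_emb.
have [a lta eqa] := special_gadget f_emb ltb eqb.
exists b, a; split=> // j ltj; apply: (gadget_orthogonal f_emb _ eqa) => //.
by rewrite /ngadgets /npaths; lia.
Qed.

Section Construction.
Variables a b : nat.
Hypotheses (a_lt : a < N) (b_lt : b < N).
Hypothesis orthogonal : forall j, j < D -> bh b j -> bg (N - 1 + a) j.

Let d_gt0 : 0 < d. Proof. exact: ltnW. Qed.

Definition move_gadget g := if g == b then N - 1 + a else twist d l b g.

(** Where the bit is clear in [H] but set in [G], the target [Flip] hangs from the leaf and not from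
    [Pin]; [Tail] is the child of [Pin] that takes its place. *)
Definition move_slot g t :=
  if t is Flip j then
    if bh g j then Flip j else if bg (move_gadget g) j then Tail j else Flip j
  else t.

(** Level [k] is twisted by the ancestor of [b] on that level, which makes the twists of successive
    levels commute with taking parents. *)
Definition move v :=
  match v with
  | Top k x => Top k (twist d k (b %/ d ^ (l - k)) x)
  | Spec _ _ => v
  | Path k i =>
      if i == b then Spec k (a %/ d ^ (l - k.+1)) else Path k (twist d l b i)
  | Gad g t => Gad (move_gadget g) (move_slot g t)
  end.

Lemma twist_not_last g : g < N -> g <> b -> twist d l b g < N - 1.
Proof.
move=> ltg ng; have lt := twist_lt b d_gt0 ltg.
suff : twist d l b g <> N - 1 by lia.
by rewrite -(twist_last d_gt0 b_lt) => /(twist_inj d_gt0).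
Qed.

Lemma move_gadget_inj g h : g < N -> h < N -> move_gadget g = move_gadget h -> g = h.
Proof.
rewrite /move_gadget; case: eqP => [->|ng]; case: eqP => [->|nh] // ltg lth.
- by have := twist_not_last lth nh; lia.
- by have := twist_not_last ltg ng; lia.
- exact: twist_inj.
Qed.

Lemma move_gadget_bit g j : g < N -> j < D -> bh g j -> bg (move_gadget g) j.
Proof.
rewrite /move_gadget; case: eqP => [-> _|ng ltg _ _]; first exact: orthogonal.
exact/bg_universal/twist_not_last.
Qed.

Lemma move_spec_lt k : k < l -> a %/ d ^ (l - k.+1) < d ^ k.+1.
Proof. by move=> ltk; rewrite ltn_divLR ?expn_gt0 ?d_gt0 // -expnD subnKC. Qed.

Lemma move_valid v : vertex_valid d l D false v -> vertex_valid d l D true (move v).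
Proof.
case: v => [k x|k x|k i|g t] //=.
- by move=> /andP[-> ltx]; exact: twist_lt.
- rewrite /npaths subn0 => /andP[ltk lti]; case: eqP => [_|ni] /=.
    by rewrite ltk move_spec_lt.
  by rewrite ltk; exact: twist_not_last.
- rewrite /ngadgets /npaths => /andP[ltg Vt]; apply/andP; split.
    rewrite /move_gadget; case: eqP => [_|ng]; first by lia.
    by have := @twist_not_last g; lia.
  by case: t Vt => //= j ltj; case: ifP => // _; case: ifP.
Qed.

Lemma move_inj u v : vertex_valid d l D false u -> vertex_valid d l D false v ->
  move u = move v -> u = v.
Proof.
case: u => [k x|k x|k i|g t]; case: v => [k' x'|k' x'|k' i'|g' t'] //=.
- by move=> _ _ [<-] /(twist_inj d_gt0)->.
- by case: eqP.
- by case: eqP.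
- rewrite /npaths subn0 => /andP[_ lti] /andP[_ lti'].
  case: eqP => [->|ni]; case: eqP => [->|ni'] //; first by case=> ->.
  by case=> -> /(twist_inj d_gt0)->.
- by case: eqP.
- by case: eqP.
- rewrite /ngadgets /npaths !subn0 !addn0 => /andP[ltg Vt] /andP[ltg' Vt'].
  case=> eqg; have eg := move_gadget_inj ltg ltg' eqg; subst g'; clear eqg.
  case: t Vt => [x|x|y|j|j|j]; case: t' Vt' => [x'|x'|y'|j'|j'|j'] //= _ _;
    repeat case: ifP => ? //; by case=> ->.
Qed.

Lemma move_attach g : g < N -> move (attach d l false g) = attach d l true (move_gadget g).
Proof.
rewrite /attach /npaths subn0 /= /move_gadget => ltg; rewrite ltg /=.
case: (eqVneq g b) => [_|/eqP ng].
  by rewrite ltnNge leq_addr /= addKn prednK // subnn expn0 divn1.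
by rewrite twist_not_last.
Qed.

Lemma move_par v : vertex_valid d l D false v -> v <> Top 0 0 ->
  move v <> Top 0 0 /\ vertex_par d l D true bg (move v) = move (vertex_par d l D false bh v).
Proof.
case: v => [[|k] x|k x|[|k] i|g t] //=.
- move=> /andP[ltk ltx] _; split=> //; congr Top.
  by rewrite twist_div // divn_expn_step.
- rewrite /npaths subn0 => /andP[ltl lti] _; split; first by case: ifP.
  rewrite subnn expn0 divn1; case: eqP => [->|ni] //=.
  by rewrite twist_last.
- rewrite /npaths subn0 => /andP[ltl lti] _; split; first by case: ifP.
  by case: eqP => [_|ni] //=; rewrite divn_expn_step.
- rewrite /ngadgets /npaths subn0 addn0 => /andP[ltg Vt] _; split=> //.
  case: t Vt => [x|x|y|j|j|j] //= Vt.
  + by case: eqP => // _; rewrite move_attach.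
  + case bhj: (bh g j); first by rewrite /= (move_gadget_bit ltg Vt bhj).
    by case bgj: (bg (move_gadget g) j); rewrite /= ?bgj.
Qed.

Lemma move_embedding : @embedding H G move.
Proof. split; [exact: move_valid | exact: move_inj | by [] | exact: move_par]. Qed.

End Construction.

Theorem orthogonal_iff_embedding :
  iso_to_subtree (tree_of H) (tree_of G) <->
  exists b a, [/\ b < N, a < N & forall j, j < D -> bh b j -> bg (N - 1 + a) j].
Proof.
split=> [/iso_tree_of/embedding_orthogonal //|[b [a [ltb lta orth]]]].
by apply/iso_tree_of; exists (move a b); exact: move_embedding.
Qed.

End Orthogonality.

(** * Splitting the assignments of a formula *)

Lemma nth_flatten_at (T : Type) (x0 : T) (ss : seq (seq T)) j t :
  j < size ss -> t < size (nth [::] ss j) ->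
  nth x0 (flatten ss) (size (flatten (take j ss)) + t) = nth x0 (nth [::] ss j) t.
Proof.
move=> ltj ltt; rewrite -{1}(cat_take_drop j ss) flatten_cat nth_cat.
by rewrite ltnNge leq_addr /= addKn (drop_nth [::]) //= nth_cat ltt.
Qed.

Lemma bits_exist h (u : nat -> bool) :
  exists2 x, x < 2 ^ h & forall i, i < h -> odd (x %/ 2 ^ i) = u i.
Proof.
elim: h u => [|h IH] u; first by exists 0.
have [x ltx bits] := IH (u \o succn).
exists (u 0 + 2 * x); first by rewrite expnS; case: (u 0); lia.
have div2 : (u 0 + 2 * x) %/ 2 = x by case: (u 0); lia.
case=> [|i] lti; first by rewrite expn0 divn1; case: (u 0); lia.
by rewrite expnS divnMA div2 bits.
Qed.

Section Cnf.
Variables (n : nat) (phi : cnf n).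
Local Notation m := (size phi).
Local Notation enc := (encode_cnf phi).

Definition encode_clause (cl : clause n) : seq nat :=
  size cl :: [seq encode_literal l | l <- cl].

Local Notation blocks := [seq encode_clause cl | cl : clause n <- phi].

Definition clause_pos (j : nat) : nat := 2 + size (flatten (take j blocks)).

Lemma nth_block j : j < m -> nth [::] blocks j = encode_clause (nth [::] phi j).
Proof. by move=> ltj; rewrite (nth_map ([::] : clause n)). Qed.

Lemma nth_enc j t : j < m -> t <= size (nth [::] phi j) ->
  nth 0 enc (clause_pos j + t) = nth 0 (encode_clause (nth [::] phi j)) t.
Proof.
move=> ltj ltt; rewrite /encode_cnf /clause_pos /= nth_flatten_at ?size_map //.
  by rewrite nth_block.
by rewrite nth_block //= size_map ltnS.
Qed.

Lemma nth_clause_pos j : j < m ->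
  nth 0 enc (clause_pos j) = size (nth [::] phi j).
Proof. by move=> ltj; rewrite -[clause_pos j]addn0 nth_enc. Qed.

Lemma clause_posS j : j < m ->
  clause_pos j.+1 = clause_pos j + nth 0 enc (clause_pos j) + 1.
Proof.
move=> ltj; rewrite nth_clause_pos //.
rewrite /clause_pos (take_nth [::]) ?size_map // flatten_rcons size_cat nth_block //=.
by rewrite size_map; lia.
Qed.

Lemma clause_pos_size : clause_pos m = size enc.
Proof. by rewrite /clause_pos take_oversize ?size_map. Qed.

Lemma clause_pos_mono i j : i <= j -> j <= m -> clause_pos i <= clause_pos j.
Proof.
move=> /subnKC<-; elim: (j - i) => [|k IH] lek; first by rewrite addn0.
by rewrite addnS clause_posS -?addnS //; have := IH; lia.
Qed.

Lemma clause_pos_lt j t : j < m -> t <= size (nth [::] phi j) ->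
  clause_pos j + t < size enc.
Proof.
move=> ltj ltt; rewrite -clause_pos_size.
apply: leq_trans (clause_pos_mono ltj (leqnn _)).
by rewrite clause_posS // nth_clause_pos //; lia.
Qed.

(* Half assignments are numbers: bit [i %/ 2] of [x] is the value of the
   variable [i], for those [i] whose parity is [sp]. *)
Definition half_sat (sp : bool) (x j : nat) : bool :=
  (m <= j) || has (fun l : literal n =>
    (odd l.1 == sp) && (odd (x %/ 2 ^ (l.1 %/ 2)) == l.2)) (nth [::] phi j).

Lemma satisfiable_halves N D : m <= D -> 2 ^ uphalf n <= N ->
  satisfiable phi <-> exists b a,
    [/\ b < N, a < N
      & forall j, j < D -> ~~ half_sat false b j -> half_sat true a j].
Proof.
move=> leD leN; split.
- move=> [al /allP sat].
  pose value i := if insub i is Some o then al o else false.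
  have [b ltb bitb] := bits_exist (uphalf n) (fun i => value (2 * i)).
  have [a lta bita] := bits_exist (uphalf n) (fun i => value (2 * i + 1)).
  exists b, a; split; [exact: leq_trans leN | exact: leq_trans leN |].
  move=> j _; rewrite /half_sat; have [//|ltj] := leqP m j.
  have /hasP[l inl /eqP all] := sat _ (mem_nth [::] ltj).
  have value_l : value l.1 = l.2.
    rewrite /value (insubT (fun i => i < n) (ltn_ord l.1)) -all; congr (al _).
    exact: val_inj.
  have lth : l.1 %/ 2 < uphalf n by have := ltn_ord l.1; lia.
  case oddl: (odd l.1) => /=.
    move=> _; apply/hasP; exists l => //; rewrite oddl bita //= -value_l.
    by rewrite [X in _ == value X](divn_eq _ 2) modn2 oddl mulnC.
  move/negP; case; apply/hasP; exists l => //; rewrite oddl bitb //= -value_l.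
  by rewrite [X in _ == value X](divn_eq _ 2) modn2 oddl mulnC addn0.
- move=> [b [a [_ _ orth]]].
  exists [ffun i : 'I_n => odd ((if odd i then a else b) %/ 2 ^ (i %/ 2))].
  apply/allP => cl incl; pose j := index cl phi.
  have ltj : j < m by rewrite index_mem.
  have eqcl : nth [::] phi j = cl by rewrite nth_index.
  have : half_sat false b j || half_sat true a j.
    by case: (boolP (half_sat false b j)) => //= /orth; apply; lia.
  rewrite /half_sat leqNgt ltj eqcl /=.
  case/orP=> /hasP[l inl /andP[/eqP oddl bitl]]; apply/hasP; exists l => //.
    by rewrite ffunE oddl.
  by rewrite ffunE oddl.
Qed.

End Cnf.

(** Padding with blanks injects the clauses into the [k]-tuples over the [2 * n] literals and one
    blank. *)
Lemma kcnf_size k n (phi : cnf n) : kcnf k phi -> size phi <= (2 * n + 1) ^ k.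
Proof.
move=> /andP[uphi /allP szphi].
pose fill (cl : seq ('I_n * bool)) := map Some cl ++ nseq (k - size cl) None.
have fillK cl : pmap id (fill cl) = cl.
  rewrite pmap_cat (_ : pmap id (nseq _ _) = [::]) ?cats0; last by elim: (k - _).
  by elim: cl => //= x cl ->.
pose pad cl : k.-tuple (option ('I_n * bool)) :=
  insubd (nseq_tuple k None) (fill cl).
have val_pad cl : cl \in (phi : seq (seq ('I_n * bool))) -> val (pad cl) = fill cl.
  move=> incl; rewrite val_insubd size_cat size_map size_nseq subnKC ?eqxx //.
  exact: szphi.
have pad_inj : {in phi : seq (seq ('I_n * bool)) &, injective pad}.
  move=> c1 c2 in1 in2 eq12.
  by rewrite -[c1]fillK -[c2]fillK -!val_pad // eq12.
rewrite -(size_map pad (phi : seq (seq _))).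
have /card_uniqP <- : uniq (map pad (phi : seq (seq ('I_n * bool)))).
  by rewrite map_inj_in_uniq.
apply: leq_trans (max_card _) _.
by rewrite card_tuple card_option card_prod card_ord card_bool mulnC addn1.
Qed.

Lemma size_encode_cnf k n (phi : cnf n) : kcnf k phi ->
  size (encode_cnf phi) <= 2 + size phi * (k + 1).
Proof.
move=> /andP[_ /allP szphi]; rewrite /encode_cnf /= size_flatten /shape -map_comp.
rewrite !ltnS sumnE big_map -sum1_size big_distrl /= big_seq [leqRHS]big_seq.
apply: leq_sum => cl incl /=.
by rewrite size_map mul1n addn1 ltnS szphi.
Qed.

(** * Running time and word size *)

(** One constant serves as factor and as exponent, as in [ksat_solvable]. *)
Definition poly_bounded (f : nat -> nat) : Prop :=
  exists K, forall Q, f Q <= K * Q.+1 ^ K.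

Lemma poly_bounded_const c : poly_bounded (fun=> c).
Proof. by exists c => Q; rewrite leq_pmulr // expn_gt0. Qed.

Lemma poly_bounded_leq f g : (forall Q, f Q <= g Q) -> poly_bounded g -> poly_bounded f.
Proof. by move=> le [K H]; exists K => Q; exact: leq_trans (le Q) (H Q). Qed.

Lemma poly_bounded_add f g : poly_bounded f -> poly_bounded g ->
  poly_bounded (fun Q => f Q + g Q).
Proof.
move=> [K1 H1] [K2 H2]; exists (K1 + K2) => Q; rewrite mulnDl leq_add //.
  by apply: leq_trans (H1 Q) _; rewrite leq_mul2l leq_pexp2l ?leq_addr ?orbT.
by apply: leq_trans (H2 Q) _; rewrite leq_mul2l leq_pexp2l ?leq_addl ?orbT.
Qed.

Lemma poly_bounded_mul f g : poly_bounded f -> poly_bounded g ->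
  poly_bounded (fun Q => f Q * g Q).
Proof.
move=> [K1 H1] [K2 H2]; exists (K1 * K2 + (K1 + K2)) => Q.
apply: leq_trans (leq_mul (H1 Q) (H2 Q)) _.
rewrite mulnACA -expnD; apply: leq_mul; first exact: leq_addr.
by rewrite leq_pexp2l // leq_addl.
Qed.

Lemma poly_bounded_id : poly_bounded id.
Proof. by exists 1 => Q; rewrite mul1n expn1 leqnSn. Qed.

Lemma cost_poly_bounded e : poly_bounded (cost ^~ e).
Proof.
elim: e => [i|c|o a IHa b IHb|a IHa|c IHc a IHa b IHb|cnt IHc ini IHi body IHb] /=;
  repeat (apply: poly_bounded_add || apply: poly_bounded_mul) => //;
  by [exact: poly_bounded_const | exact: poly_bounded_id].
Qed.

Fixpoint straight (c : cmd) : bool :=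
  match c with
  | Let _ c => straight c
  | Write _ _ => true
  | Then c1 c2 => straight c1 && straight c2
  | For _ _ => false
  end.

(** Without nested [For] loops the cost is linear in [X]. This is essential: [X] is about
    [2 ^ (n / 2)], and its square would exceed the target time. *)
Fixpoint flat (c : cmd) : bool :=
  match c with
  | Let _ c => flat c
  | Write _ _ => true
  | Then c1 c2 => flat c1 && flat c2
  | For _ body => straight body
  end.

Lemma ccost_straight c : straight c ->
  exists2 f, poly_bounded f & forall Q X, ccost Q X c <= f Q.
Proof.
elim: c => [e c IH|a v _|c1 IH1 c2 IH2|//] /=.
- move=> /IH[f pf le]; exists (fun Q => cost Q e + f Q).
    exact: poly_bounded_add (cost_poly_bounded e) pf.
  by move=> Q X; rewrite leq_add2l.
- exists (fun Q => cost Q a + cost Q v + 1) => //.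
  apply: poly_bounded_add (poly_bounded_const 1).
  exact: poly_bounded_add (cost_poly_bounded a) (cost_poly_bounded v).
- move=> /andP[/IH1[f pf le] /IH2[g pg le']]; exists (fun Q => f Q + g Q).
    exact: poly_bounded_add pf pg.
  by move=> Q X; rewrite leq_add.
Qed.

Lemma ccost_flat c : flat c ->
  exists2 f, poly_bounded f & forall Q X, ccost Q X c <= f Q * X.+1.
Proof.
elim: c => [e c IH|a v _|c1 IH1 c2 IH2|cnt body _] /=.
- move=> /IH[f pf le]; exists (fun Q => cost Q e + f Q).
    exact: poly_bounded_add (cost_poly_bounded e) pf.
  by move=> Q X; have := le Q X; nia.
- exists (fun Q => cost Q a + cost Q v + 1); last by move=> *; rewrite leq_pmulr.
  apply: poly_bounded_add (poly_bounded_const 1).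
  exact: poly_bounded_add (cost_poly_bounded a) (cost_poly_bounded v).
- move=> /andP[/IH1[f pf le] /IH2[g pg le']]; exists (fun Q => f Q + g Q).
    exact: poly_bounded_add pf pg.
  by move=> Q X; rewrite mulnDl leq_add.
- move=> /ccost_straight[f pf le]; exists (fun Q => cost Q cnt + (f Q + 6)).
    apply: poly_bounded_add (cost_poly_bounded cnt) _.
    by apply: poly_bounded_add pf _; exact: poly_bounded_const.
  move=> Q X; have := le Q X; nia.
Qed.

Fixpoint tame (K nv : nat) (e : expr) : bool :=
  match e with
  | Var i => i < nv
  | Lit c => c <= K
  | Bin o a b =>
      match o with Or | Xor | Shl | And => false | _ => tame K nv a && tame K nv b end
  | Read a => tame K nv a
  | Ite c a b => [&& tame K nv c, tame K nv a & tame K nv b]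
  | Iter _ _ _ => false
  end.

Fixpoint leaves (e : expr) : nat :=
  match e with
  | Var _ | Lit _ => 1
  | Bin _ a b => leaves a + leaves b
  | Read a => leaves a
  | Ite c a b => leaves c + leaves a + leaves b
  | Iter _ _ _ => 1
  end.

Lemma leaves_gt0 e : 0 < leaves e.
Proof. by elim: e => //= *; lia. Qed.

(** Bit lengths add up: the sum or product of numbers of [p > 0] and [q > 0] bits has at most
    [p + q] bits. So [b] bits per leaf bound all intermediate values, and no loop-free expression
    needs an overflow analysis of its own. *)
Lemma tame_safe K w Q b m vs e : 0 < b -> K < 2 ^ b ->
  (forall i, nth 0 vs i < 2 ^ b) -> (forall i, m i < 2 ^ b) ->
  tame K (size vs) e -> leaves e * b <= w ->
  safe w Q m vs e /\ eval m vs e < 2 ^ (leaves e * b).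
Proof.
move=> b_gt0 ltK ltv ltm.
suff H : tame K (size vs) e -> leaves e * b <= w ->
    eval m vs e < 2 ^ (leaves e * b) /\ (eval m vs e < 2 ^ w -> safe w Q m vs e).
  move=> te le; have [lt safee] := H te le; split=> //; apply: safee.
  by apply: leq_trans lt _; rewrite leq_exp2l.
elim: e => [i|c|o x IHx y IHy|x IHx|c IHc x IHx y IHy|//] /=.
- by rewrite mul1n.
- by rewrite mul1n => leK _; split=> //; exact: leq_ltn_trans leK ltK.
- rewrite mulnDl => T le.
  have [tx ty] : tame K (size vs) x /\ tame K (size vs) y.
    by case: o T => // /andP[].
  have [|ltx safex] := IHx tx; first lia.
  have [|lty safey] := IHy ty; first lia.
  have px : 0 < leaves x * b by rewrite muln_gt0 leaves_gt0.
  have py : 0 < leaves y * b by rewrite muln_gt0 leaves_gt0.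
  have lift z p : p <= w -> z < 2 ^ p -> z < 2 ^ w.
    by move=> lep ltz; apply: leq_trans ltz _; rewrite leq_exp2l.
  split; last first.
    move=> lt; split=> //; split; [apply: safex | apply: safey].
      by apply: lift ltx; lia.
    by apply: lift lty; lia.
  have lex : 2 ^ (leaves x * b) <= 2 ^ (leaves x * b + leaves y * b).
    by rewrite leq_exp2l // leq_addr.
  have le2 p : 0 < p -> 1 < 2 ^ p by move=> p_gt0; rewrite -{1}(expn0 2) ltn_exp2l.
  have le2x := le2 _ px; have le2y := le2 _ py.
  move: (eval m vs x) (eval m vs y) ltx lty {safex safey IHx IHy} => X Y ltx lty.
  case: o T => //= _.
  + by rewrite expnD; nia.
  + by lia.
  + by rewrite expnD; apply: ltn_mul.
  + by apply: leq_ltn_trans (leq_div _ _) _; lia.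
  + by apply: leq_ltn_trans (leq_mod _ _) _; lia.
  + by apply: leq_ltn_trans (leq_div _ _) _; lia.
  + by case: (X == Y); lia.
  + by case: (X < Y); lia.
- move=> tx le; have [ltx safex] := IHx tx le; split.
    by apply: leq_trans (ltm _) _; rewrite leq_exp2l // leq_pmull ?leaves_gt0.
  move=> _; split; last apply: safex.
    by apply: leq_trans (ltm _) _; rewrite leq_exp2l //; have := leaves_gt0 x; nia.
  by apply: leq_trans ltx _; rewrite leq_exp2l.
- rewrite !mulnDl => /and3P[tc tx ty] le.
  have [|ltc safec] := IHc tc; first lia.
  have [|ltx safex] := IHx tx; first lia.
  have [|lty safey] := IHy ty; first lia.
  have lift z p q : p <= q -> z < 2 ^ p -> z < 2 ^ q.
    by move=> lep ltz; apply: leq_trans ltz _; rewrite leq_exp2l.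
  split; first by case: ifP => _; [apply: lift ltx | apply: lift lty]; lia.
  move=> lt; split=> //; split; first by apply: safec; apply: lift ltc; lia.
  by case: ifP => _; [apply/safex/(lift _ _ _ _ ltx) | apply/safey/(lift _ _ _ _ lty)]; lia.
Qed.

(** * The program that writes the trees *)

Local Notation "x +' y" := (Bin Add x y) (at level 50, left associativity).
Local Notation "x -' y" := (Bin Sub x y) (at level 50, left associativity).
Local Notation "x *' y" := (Bin Mul x y) (at level 40, left associativity).
Local Notation "x /' y" := (Bin Div x y) (at level 40, left associativity).
Local Notation "x %' y" := (Bin Mod x y) (at level 40, left associativity).
Local Notation "x <' y" := (Bin Lt x y) (at level 70).
Local Notation "x =' y" := (Bin Eq x y) (at level 70).

Definition yields (w Q : nat) (m : nat -> nat) (vs : seq nat) (e : expr) (v : nat) : Prop :=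
  safe w Q m vs e /\ eval m vs e = v.

Lemma yields_iter w Q m vs cnt ini body c (f : nat -> nat) :
  yields w Q m vs cnt c -> yields w Q m vs ini (f 0) -> c <= Q ->
  (forall i, i < c -> yields w Q m (vs ++ [:: f i; i]) body (f i.+1)) ->
  yields w Q m vs (Iter cnt ini body) (f c).
Proof.
move=> [safec evalc] [safei evali] leQ bodyP.
have iterE i : i <= c ->
    iteri i (fun i acc => eval m (vs ++ [:: acc; i]) body) (eval m vs ini) = f i.
  elim: i => [|i IH] lti //=; rewrite IH; last exact: ltnW.
  by have [_ ->] := bodyP i lti.
split; last by rewrite /= evalc iterE.
split; last first.
  rewrite evalc; split=> // i lti; rewrite iterE; last exact: ltnW.
  by have [] := bodyP i lti.
rewrite /= evalc iterE //.
have : f c < 2 ^ w; last by [].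
case: c leQ bodyP {evalc iterE} => [|c] _ bodyP.
  by rewrite -evali; exact: safe_lt safei.
have [safeb <-] := bodyP c (ltnSn c); exact: safe_lt safeb.
Qed.

Lemma yields_bin w Q m vs o x y u v :
  yields w Q m vs x u -> yields w Q m vs y v -> eval_binop o u v < 2 ^ w ->
  yields w Q m vs (Bin o x y) (eval_binop o u v).
Proof. by move=> [sx ex] [sy ey] lt; split; rewrite /= ex ey. Qed.

(** [nv] is the number of variables in scope, hence the index of the accumulator in the body. *)
Definition powE (base : nat) (e : expr) (nv : nat) : expr :=
  Iter e (Lit 1) (Var nv *' Lit base).

Definition climbE (base : nat) (target cnt : expr) (nv : nat) : expr :=
  Iter cnt (Lit 1) (Var nv +' (powE base (Var nv) (nv + 2) <' target)).

Definition offsetE (base : nat) (cnt : expr) (nv : nat) : expr :=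
  Iter cnt (Lit 0) (Var nv *' Lit base +' Lit 1).

(** The first block starts at address 2, and each is passed by means of its stored length. Passing
    all clauses yields the end of the formula, where the trees are written. *)
Definition posE (cnt : expr) (nv : nat) : expr :=
  Iter cnt (Lit 2) (Var nv +' Read (Var nv) +' Lit 1).

(* The least exponent [a >= 1] with [T <= base ^ a], found in [c] steps. *)
Definition climb (base T c : nat) : nat :=
  iteri c (fun _ a => a + (base ^ a < T)) 1.

Lemma climbS base T c :
  climb base T c.+1 = climb base T c + (base ^ climb base T c < T).
Proof. by []. Qed.

Lemma climb_mono base T i j : i <= j -> climb base T i <= climb base T j.
Proof.
move=> /subnKC<-; elim: (j - i) => [|k IH]; first by rewrite addn0.
by rewrite addnS climbS; lia.
Qed.

Lemma climb_gt0 base T c : 0 < climb base T c.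
Proof. by elim: c => // c IH; rewrite climbS; lia. Qed.

Lemma climb_le base T c : climb base T c <= c.+1.
Proof. by elim: c => // c IH; rewrite climbS; case: (_ < T); lia. Qed.

Lemma climb_reaches base T c : T <= base ^ c.+1 -> T <= base ^ climb base T c.
Proof.
suff H : T <= base ^ climb base T c \/ climb base T c = c.+1.
  by case: H => // ->.
elim: c => [|c IH]; first by right.
rewrite climbS; case: ltnP => [lt|le]; last by left; rewrite addn0.
by case: IH => [|->]; [lia | right; rewrite addn1].
Qed.

(** The exponent grows only while the power is below [T], so at most one factor [base] is lost. *)
Lemma climb_tight base T c : 0 < base -> 0 < T -> base ^ climb base T c <= base * T.
Proof.
move=> base_gt0 T_gt0; elim: c => [|c IH]; first by rewrite expn1 leq_pmulr.
rewrite climbS; case: ltnP => [lt|le]; last by rewrite addn0.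
by rewrite addn1 expnS leq_mul2l ltnW ?orbT.
Qed.

Definition fits (b : nat) (vs : seq nat) : Prop := forall i, nth 0 vs i < 2 ^ b.

Lemma fits_cat b vs x y :
  fits b vs -> x < 2 ^ b -> y < 2 ^ b -> fits b (vs ++ [:: x; y]).
Proof.
move=> Hv ltx lty i; rewrite nth_cat; case: ifP => // _.
by case: (i - size vs) => [|[|j]] //=; rewrite nth_nil expn_gt0.
Qed.

Lemma fits_all b vs : all (fun x => x < 2 ^ b) vs -> fits b vs.
Proof.
move=> /allP H i; have [lti|lei] := ltnP i (size vs).
  exact/H/mem_nth.
by rewrite nth_default // expn_gt0.
Qed.

Section Loops.
Variables (K w Q b : nat) (m : nat -> nat).
Hypotheses (b_gt0 : 0 < b) (K_lt : K < 2 ^ b) (K_gt1 : 1 < K).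
(** 200 is a generous bound on the number of leaves of the expressions to which [yields_tame] is
    applied. *)
Hypothesis w_large : 200 * b <= w.
Hypothesis m_lt : forall a, m a < 2 ^ b.

Lemma yields_tame vs e v : fits b vs -> tame K (size vs) e -> leaves e <= 200 ->
  eval m vs e = v -> yields w Q m vs e v.
Proof.
move=> Hv te le eqv; split=> //.
have [|//] := @tame_safe K w Q b m vs e b_gt0 K_lt Hv m_lt te.
by apply: leq_trans w_large; rewrite leq_mul2r le orbT.
Qed.

Lemma yields_pow vs base e c : fits b vs -> yields w Q m vs e c -> base <= K ->
  0 < base -> c <= Q -> c < 2 ^ b -> base ^ c < 2 ^ b ->
  yields w Q m vs (powE base e (size vs)) (base ^ c).
Proof.
move=> Hv He leK base_gt0 leQ ltc ltp; apply: (yields_iter (f := expn base)) => //.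
  by apply: yields_tame => //; exact: ltnW.
move=> i lti.
have Hi : fits b (vs ++ [:: base ^ i; i]).
  apply: fits_cat => //; last by lia.
  by apply: leq_ltn_trans ltp; rewrite leq_pexp2l // ltnW.
apply: yields_tame => //=.
  by rewrite size_cat /= leK andbT; lia.
by rewrite nth_cat ltnn subnn /= expnSr.
Qed.

Lemma yields_climb vs base te e T c : fits b vs -> yields w Q m vs e c ->
  (forall vs', yields w Q m (vs ++ vs') te T) ->
  base <= K -> 1 < base -> c <= Q -> climb base T c <= Q ->
  base ^ climb base T c < 2 ^ b ->
  c < 2 ^ b ->
  yields w Q m vs (climbE base te e (size vs)) (climb base T c).
Proof.
move=> Hv He HT leK base_gt1 leQ leQ' ltp ltc.
apply: (yields_iter (f := climb base T)) => //.
  by apply: yields_tame => //; exact: ltnW.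
move=> i lti; have lecl := climb_mono base T (ltnW lti).
set a := climb base T i in lecl *.
have lea : base ^ a <= base ^ climb base T c by rewrite leq_pexp2l // ltnW.
have lta : a < base ^ a by exact: ltn_expl.
have Hi : fits b (vs ++ [:: a; i]) by apply: fits_cat => //; lia.
have Va : yields w Q m (vs ++ [:: a; i]) (Var (size vs)) a.
  apply: yields_tame => //=; first by rewrite size_cat /=; lia.
  by rewrite nth_cat ltnn subnn.
have lt_w : 2 ^ b < 2 ^ w by rewrite ltn_exp2l //; lia.
rewrite climbS -/a -[a + _]/(eval_binop Add a _).
apply: yields_bin => //; last by rewrite /=; case: (_ < T); lia.
rewrite -[nat_of_bool _]/(eval_binop Lt (base ^ a) T).
apply: yields_bin => //; last by rewrite /=; case: (_ < T); lia.
have -> : size vs + 2 = size (vs ++ [:: a; i]) by rewrite size_cat.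
by apply: yields_pow => //; lia.
Qed.

Lemma yields_offset vs base e c : fits b vs -> yields w Q m vs e c -> base <= K ->
  c <= Q -> c < 2 ^ b -> offset base c < 2 ^ b ->
  yields w Q m vs (offsetE base e (size vs)) (offset base c).
Proof.
move=> Hv He leK leQ ltc lto; apply: (yields_iter (f := offset base)) => //.
  exact: yields_tame.
move=> i lti.
have Hi : fits b (vs ++ [:: offset base i; i]).
  apply: fits_cat => //; last by lia.
  by apply: leq_ltn_trans lto; rewrite leq_offset // ltnW.
apply: yields_tame => //=.
  by rewrite size_cat /= leK; lia.
by rewrite nth_cat ltnn subnn /= offset_rec.
Qed.

Lemma yields_pos n (phi : cnf n) vs e c : fits b vs -> yields w Q m vs e c ->
  (forall a, a < size (encode_cnf phi) -> m a = nth 0 (encode_cnf phi) a) ->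
  size (encode_cnf phi) < 2 ^ b ->
  c <= size phi -> c <= Q -> c < 2 ^ b ->
  yields w Q m vs (posE e (size vs)) (clause_pos phi c).
Proof.
move=> Hv He Hm ltB lec leQ ltc; apply: (yields_iter (f := clause_pos phi)) => //.
  by rewrite /clause_pos take0 /=; apply: yields_tame.
move=> i lti.
have lti' : i < size phi by lia.
have lt_pos : clause_pos phi i < size (encode_cnf phi).
  by rewrite -[clause_pos _ _]addn0; apply: clause_pos_lt.
have Hi : fits b (vs ++ [:: clause_pos phi i; i]) by apply: fits_cat => //; lia.
apply: yields_tame => //=; first by rewrite size_cat /=; lia.
by rewrite nth_cat ltnn subnn /= Hm // clause_posS.
Qed.

End Loops.

Definition performs (w Q X : nat) (m : nat -> nat) (vs : seq nat) (c : cmd)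
    (m' : nat -> nat) : Prop :=
  csafe w Q X m vs c /\ run m vs c = m'.

Lemma performs_let w Q X m vs e c v m' : yields w Q m vs e v ->
  performs w Q X m (vs ++ [:: v]) c m' -> performs w Q X m vs (Let e c) m'.
Proof. by move=> [se ev] [sc rc]; split; rewrite /= ev. Qed.

Lemma performs_write w Q X m vs a e u v : yields w Q m vs a u -> yields w Q m vs e v ->
  performs w Q X m vs (Write a e) (upd m u v).
Proof. by move=> [sa ea] [se ev]; split; rewrite //= ea ev. Qed.

Lemma performs_then w Q X m vs c1 c2 m1 m2 : performs w Q X m vs c1 m1 ->
  performs w Q X m1 vs c2 m2 -> performs w Q X m vs (Then c1 c2) m2.
Proof. by move=> [s1 e1] [s2 e2]; split; rewrite /= e1. Qed.

Lemma performs_for w Q X vs cnt body c (f : nat -> nat -> nat) :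
  yields w Q (f 0) vs cnt c -> c <= X ->
  (forall i, i < c -> performs w Q X (f i) (vs ++ [:: i]) body (f i.+1)) ->
  performs w Q X (f 0) vs (For cnt body) (f c).
Proof.
move=> [sc ec] leX bodyP.
have iterE i : i <= c ->
    iteri i (fun i m' => run m' (vs ++ [:: i]) body) (f 0) = f i.
  elim: i => [|i IH] lti //=; rewrite IH; last exact: ltnW.
  by have [_ ->] := bodyP i lti.
split; rewrite /= ec; last exact: iterE.
split=> // i lti; rewrite iterE; last exact: ltnW.
by have [] := bodyP i lti.
Qed.

(* Variables of the emitter:
     0  end of the formula      8  number of paths       16 offset in the gadget
     1  variables               9  first path vertex     17 coordinate
     2  clauses                10  first gadget vertex   18 is it a clause?
     3  coordinates            11  gadget size           19 half assignment
     4  2 ^ uphalf n           12  tree size             20 position of the clause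
     5  depth                  13  output address        21 is it satisfied?
     6  leaves                 14  vertex                22 gadget bit
     7  vertices of the heap   15  gadget *)
Definition litE : expr := Read (Var 20 +' Var 22 +' Lit 1).

Definition testE (sp : bool) : expr :=
  ((litE /' Lit 2 %' Lit 2) =' Lit sp) *'
  ((Bin Shr (Var 19) (litE /' Lit 2 /' Lit 2) %' Lit 2) =' (litE %' Lit 2)).

(** For a coordinate past the last clause no literal is read and the initial value is 1, in
    accordance with [half_sat]. *)
Definition satE (sp : bool) : expr :=
  Iter (Ite (Var 18) (Read (Var 20)) (Lit 0)) (Var 18 =' Lit 0)
    (Lit 0 <' (Var 21 +' testE sp)).

Definition bitE (sp : bool) : expr :=
  if sp then Lit 0 <' ((Var 15 <' Var 8) +' Var 21) else Var 21 =' Lit 0.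

Definition attachE : expr :=
  Ite (Var 15 <' Var 8) (Var 10 -' Var 8 +' Var 15)
    (Var 7 -' Lit 1 +' (Var 7 -' Var 6) +' (Var 15 -' Var 8)).

Definition gadget_parE : expr :=
  let v := Var 14 in let z := Var 16 in
  let times c := Lit c *' Var 3 in
  Ite (z <' times 2) (v +' times 2)
  (Ite (z =' times 2) attachE
  (Ite (z <' times 4) (v -' z +' (z -' times 2) /' Lit 2)
  (Ite (z <' times 5) (v -' z +' times 2 +' Lit 2 *' (z -' times 4))
  (Ite (z <' times 6) (v -' times 4)
  (Ite (z <' times 7) (Ite (Var 22) (v -' times 5) (v -' Var 3))
    (v -' times 2)))))).

Definition parE (d : nat) : expr :=
  let v := Var 14 in
  Ite (v <' Var 7) ((v -' Lit 1) /' Lit d)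
  (Ite (v <' Var 9) (Var 7 -' Lit 1 +' (v -' Var 7) /' Lit d)
  (Ite (v <' Var 9 +' Var 8) (v -' Var 9 +' (Var 7 -' Var 6))
  (Ite (v <' Var 10) (v -' Var 8)
    gadget_parE))).

(** The gadget data are computed for every vertex, which keeps the body free of [For] loops. Where
    they have no meaning, truncated differences still keep all addresses and values in range, and
    the parent does not depend on them. *)
Definition write_parent (d : nat) (sp : bool) : cmd :=
  Let ((Var 14 -' Var 10) /' Var 11)
  (Let ((Var 14 -' Var 10) %' Var 11)
  (Let (Var 16 -' Lit 6 *' Var 3)
  (Let (Var 17 <' Var 2)
  (Let (Var 15 -' Lit sp *' Var 8)
  (Let (posE (Var 18 *' Var 17) 20)
  (Let (satE sp)
  (Let (bitE sp)
  (Write (Var 13 +' Lit 2 +' Var 14) (parE d))))))))).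

Definition emit (d : nat) (sp : bool) : cmd :=
  Let (Var 6 -' Lit sp)
  (Let (Var 7 +' Lit sp *' (Var 7 -' Lit 1))
  (Let (Var 9 +' Var 5 *' Var 8)
  (Let ((Lit 7 +' Lit sp) *' Var 3)
  (Let (Var 10 +' (Var 8 +' Lit sp *' Var 6) *' Var 11)
  (Let (Var 0 +' Lit sp *'
         (Lit 2 +' (Var 7 +' Var 5 *' Var 6 +' Var 6 *' (Lit 7 *' Var 3))))
  (Then (Write (Var 13) (Var 12))
    (For (Var 12) (write_parent d sp)))))))).

Definition build (d : nat) : cmd :=
  Let (Read (Lit 0))
  (Let (Read (Lit 1))
  (Let (Var 1 +' Var 2 +' Lit 1)
  (Let (powE 2 ((Var 1 +' Lit 1) /' Lit 2) 4)
  (Let (climbE d (Var 4) (Var 1) 5)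
  (Let (powE d (Var 5) 6)
  (Let (offsetE d (Var 5 +' Lit 1) 7)
  (Then (emit d false) (emit d true)))))))).

Lemma build_flat d : flat (build d).
Proof. by []. Qed.

Lemma Ite_bool (T : Type) (c : bool) (x y : T) :
  (if nat_of_bool c != 0 then x else y) = if c then x else y.
Proof. by case: c. Qed.

(** * The two trees of a formula *)

Section SatTree.
Variables (d n : nat) (phi : cnf n).
Hypothesis d_gt1 : 1 < d.

(** The surplus [n + 1] makes the number of coordinates positive and at least the depth [l], so that
    [N * D] also bounds the paths of length [l]. *)
Definition ncoords := n + size phi + 1.
Definition nassign := 2 ^ ((n + 1) %/ 2).
Definition depth_of := climb d nassign n.

Local Notation D := ncoords.
Local Notation l := depth_of.
Local Notation N := (d ^ l).
Local Notation U := (offset d l.+1).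
Definition tree_order (sp : bool) := family_order d l D sp.

Definition tree_bit (sp : bool) (g j : nat) : bool :=
  if sp then (g < npaths d l true) || half_sat phi true (g - npaths d l true) j
  else ~~ half_sat phi false g j.

Definition tree_par (sp : bool) := family_par d l D sp (tree_bit sp).

Lemma l_gt0 : 0 < l.
Proof. exact: climb_gt0. Qed.

Lemma D_gt0 : 0 < D.
Proof. by rewrite /ncoords addn1. Qed.

Lemma N_gt1 : 1 < N.
Proof. by rewrite -(expn0 d) ltn_exp2l // l_gt0. Qed.

Lemma U_eq : U = offset d l + N.
Proof. exact: offsetS. Qed.

Lemma tree_order_ge sp :
  [/\ 7 * D <= tree_order sp, N <= U, U <= path_base d l sp,
      path_base d l sp <= gadget_base d l sp
    & gadget_base d l sp <= tree_order sp] /\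
  [/\ npaths d l sp <= N, l < N, gadget_size D sp <= tree_order sp
    & ngadgets d l sp * gadget_size D sp <= tree_order sp].
Proof.
have := N_gt1; have := U_eq; have := D_gt0 => D_pos Ueq N1.
have secs := sections sp d_gt1 l_gt0 D_gt0.
have gpos : 0 < ngadgets d l sp.
  by rewrite /ngadgets /npaths; case: sp {secs} => /=; lia.
have leZ : 7 * D <= gadget_size D sp by rewrite /gadget_size; case: sp {secs gpos} => /=; lia.
have leg : gadget_size D sp <= ngadgets d l sp * gadget_size D sp by rewrite leq_pmull.
have ll : l < N by exact: ltn_expl.
rewrite /tree_order /family_order; split; split=> //; try lia.
by rewrite /npaths; lia.
Qed.

(** Climbing [n] steps is enough, because [nassign <= 2 ^ n.+1 <= d ^ n.+1]. *)
Lemma nassign_le : nassign <= N.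
Proof.
apply: climb_reaches; apply: (@leq_trans (2 ^ n.+1)); last by rewrite leq_exp2r.
by rewrite leq_exp2l //; lia.
Qed.

Lemma tree_par_lt sp v : v < tree_order sp -> tree_par sp v < tree_order sp.
Proof.
exact (@npar_lt (tree_family sp (tree_bit sp) d_gt1 l_gt0 D_gt0) v).
Qed.

Definition sat_tree (sp : bool) : rtree :=
  tree_of (tree_family sp (tree_bit sp) d_gt1 l_gt0 D_gt0).

Lemma encode_sat_tree sp : encode_tree (sat_tree sp) =
  tree_order sp :: 0 :: [seq tree_par sp v | v <- iota 0 (tree_order sp)].
Proof. exact: encode_tree_of. Qed.

Lemma sat_trees_iso :
  iso_to_subtree (sat_tree false) (sat_tree true) <-> satisfiable phi.
Proof.
have universal g j : g < N - 1 -> tree_bit true g j.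
  by move=> ltg; rewrite /tree_bit /npaths ltg.
have leT := nassign_le.
have hT : 2 ^ uphalf n <= N by move: leT; rewrite /nassign uphalfE divn2 addn1.
have hm : size phi <= D by rewrite /ncoords; lia.
rewrite (orthogonal_iff_embedding _ d_gt1 l_gt0 D_gt0 universal).
rewrite (satisfiable_halves hm hT).
have bitE' a j : tree_bit true (N - 1 + a) j = half_sat phi true a j.
  by rewrite /tree_bit /npaths ltnNge leq_addr /= addKn.
by split=> -[x [y [ltx lty H]]]; exists x, y; split=> // j ltj hj;
  move: (H j ltj hj); rewrite bitE'.
Qed.

Lemma sat_tree_nchildren sp (v : 'I_(tsize (sat_tree sp))) : nchildren v <= d.
Proof.
apply: (@nchildren_tree_of (tree_family sp (tree_bit sp) d_gt1 l_gt0 D_gt0)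
  d (port d (tree_bit sp))).
  by move=> u _; exact: port_lt l_gt0 D_gt0 u.
move=> u v' Vu Vv nu nv; exact (port_inj d_gt1 l_gt0 D_gt0 Vu Vv nu nv).
Qed.

Lemma sat_tree_height sp L : D <= 2 ^ L -> height (sat_tree sp) <= 2 * l + 2 * L + 6.
Proof.
move=> leD; apply: height_tree_of => v Vv.
exact (ascend_family (tree_bit sp) d_gt1 l_gt0 D_gt0 leD Vv).
Qed.

End SatTree.

(** * Correctness of the written memory *)

Section Emit.
Variables (d k n : nat) (phi : cnf n) (w Q b X : nat).
Hypotheses (d_gt1 : 1 < d) (phi_kcnf : kcnf k phi).

Local Notation D := (ncoords phi).
Local Notation l := (depth_of d n).
Local Notation N := (d ^ l).
Local Notation U := (offset d l.+1).
Local Notation enc := (encode_cnf phi).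
Local Notation B := (size enc).
Local Notation tree_order := (tree_order d phi).
Local Notation tree_par := (tree_par d phi).
Local Notation tree_bit := (tree_bit d phi).
Local Notation sat_tree := (sat_tree phi d_gt1).

Hypotheses (b_gt0 : 0 < b) (w_large : 200 * b <= w).
Hypothesis b_large : B + tree_order false + tree_order true + d + k + 10 < 2 ^ b.
Hypothesis Q_large : n + size phi + k + 2 <= Q.
Hypothesis X_large : forall sp, tree_order sp <= X.

(** The formula is read again for every vertex, so it must survive the writing; the bound on all
    cells feeds [tame_safe]. *)
Definition good (m : nat -> nat) : Prop :=
  (forall a, a < B -> m a = nth 0 enc a) /\ forall a, m a < 2 ^ b.

Lemma good_upd m a v : good m -> B <= a -> v < 2 ^ b -> good (upd m a v).
Proof.
move=> [agree bound] lea ltv; split=> x; rewrite updE; last by case: eqP.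
by case: eqP => [->|_ /agree //]; lia.
Qed.

Lemma enc_lt a : nth 0 enc a < 2 ^ b.
Proof.
have [[ge7 _ _ _ _] _] := tree_order_ge phi d_gt1 false; rewrite /ncoords in ge7.
have [lta|lea] := ltnP a B; last by rewrite nth_default //; lia.
have : nth 0 enc a \in enc by exact: mem_nth.
rewrite /encode_cnf !inE => /or3P[/eqP->|/eqP->|]; [lia | lia |].
move=> /flattenP[bl /mapP[cl incl ->]]; rewrite inE => /orP[/eqP->|].
  move: phi_kcnf => /andP[_ /allP/(_ _ incl)]; lia.
move=> /mapP[[i s] _ ->]; rewrite /encode_literal /=.
by have := ltn_ord i; case: s; lia.
Qed.

Lemma good_init m : m =1 nth 0 enc -> good m.
Proof. by move=> eqm; split=> a; rewrite eqm // enc_lt. Qed.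

Definition out (sp : bool) := B + sp * (2 + tree_order false).

Definition vars8 := [:: B; n; size phi; D; nassign n; l; N; U].
Definition vars14 sp := vars8 ++
  [:: npaths d l sp; path_base d l sp; gadget_base d l sp; gadget_size D sp;
      tree_order sp; out sp].

Lemma out_lt s : out s + 2 + tree_order s <= B + tree_order false + tree_order true + 4.
Proof. by rewrite /out; case: s => /=; lia. Qed.

Lemma vars14_lt sp : all (fun x => x < 2 ^ b) (vars14 sp).
Proof.
have [[h1 h2 h3 h4 h5] [h6 h7 h8 h9]] := tree_order_ge phi d_gt1 sp.
have h10 := nassign_le n d_gt1; have h11 := out_lt sp.
have h12 : n + size phi + 1 <= D by [].
have hB : B < 2 ^ b by lia.
have hS : tree_order sp < 2 ^ b by move: b_large; case: (sp); lia.
have hout : out sp < 2 ^ b by lia.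
rewrite /vars14 /vars8; move: (B) hB => B' hB.
by rewrite /=; lia.
Qed.

Section WriteParent.
Variables (m : nat -> nat) (sp : bool) (v : nat).
Hypotheses (m_good : good m) (v_lt : v < tree_order sp).

Local Notation g := ((v - gadget_base d l sp) %/ gadget_size D sp).
Local Notation z := ((v - gadget_base d l sp) %% gadget_size D sp).
Local Notation j := (z - 6 * D).
Local Notation inb := (nat_of_bool (j < size phi)).
Local Notation x := (g - sp * npaths d l sp).

Let K := 8 + d.

Let m_lt : forall a, m a < 2 ^ b := m_good.2.

Let K_lt : K < 2 ^ b.
Proof. by rewrite /K; lia. Qed.

(* The variables 14 to 22 of a run of [write_parent]. *)
Definition vars23 := vars14 sp ++
  [:: v; g; z; j; inb; x; clause_pos phi (inb * j); nat_of_bool (half_sat phi sp x j);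
      nat_of_bool (tree_bit sp g j)].

Lemma vars23_fits i : fits b (take i vars23).
Proof.
apply: fits_all.
apply/allP => y /mem_take; rewrite mem_cat => /orP[|].
  by move/allP: (vars14_lt sp); apply.
have [[h1 h2 h3 h4 h5] [h6 h7 h8 h9]] := tree_order_ge phi d_gt1 sp.
have vo : tree_order sp < 2 ^ b by move: b_large; case: sp; lia.
have gv : g <= v by apply: leq_trans (leq_div _ _) (leq_subr _ _).
have zv : z <= v by apply: leq_trans (leq_mod _ _) (leq_subr _ _).
rewrite !inE => /or4P[/eqP->|/eqP->|/eqP->|]; [lia | lia | lia |].
move=> /or4P[/eqP->|/eqP->|/eqP->|]; [lia | by case: (j < size phi); lia | lia |].
move=> /or3P[/eqP->|/eqP->|/eqP->]; last 2 first.
- by case: half_sat; lia.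
- by case: tree_bit; lia.
apply: (@leq_ltn_trans B); last by lia.
by rewrite -clause_pos_size; apply: clause_pos_mono => //; case: (ltnP j); lia.
Qed.

Lemma eval_parE mm (B' n' m' D' T' l' N' U' Np pb gb Z S o v' g' z' j' i' x' p' s' : nat)
    (bit : bool) :
  eval mm [:: B'; n'; m'; D'; T'; l'; N'; U'; Np; pb; gb; Z; S; o; v'; g'; z'; j'; i';
              x'; p'; s'; nat_of_bool bit] (parE d) =
  if v' < U' then (v' - 1) %/ d
  else if v' < pb then U' - 1 + (v' - U') %/ d
  else if v' < pb + Np then v' - pb + (U' - N')
  else if v' < gb then v' - Np
  else if z' < 2 * D' then v' + 2 * D'
  else if z' == 2 * D' then
    if g' < Np then gb - Np + g' else U' - 1 + (U' - N') + (g' - Np)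
  else if z' < 4 * D' then v' - z' + (z' - 2 * D') %/ 2
  else if z' < 5 * D' then v' - z' + 2 * D' + 2 * (z' - 4 * D')
  else if z' < 6 * D' then v' - 4 * D'
  else if z' < 7 * D' then if bit then v' - 5 * D' else v' - D'
  else v' - 2 * D'.
Proof. by rewrite [LHS]/= !Ite_bool. Qed.

Let tameP i e val : i <= 9 -> tame K (14 + i) e -> leaves e <= 200 ->
  eval m (take (14 + i) vars23) e = val -> yields w Q m (take (14 + i) vars23) e val.
Proof.
move=> le9 te le ev; apply: (@yields_tame K w Q b m) => //.
- exact: vars23_fits.
- by rewrite size_take; move: te; case: i le9 ev => [|[|[|[|[|[|[|[|[|[|i]]]]]]]]]].
Qed.

Lemma clause_number : inb * j <= size phi.
Proof. by case: (ltnP j); lia. Qed.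

Lemma yields_sat : yields w Q m (take 21 vars23) (satE sp) (half_sat phi sp x j).
Proof.
have [agree _] := m_good.
set cl := nth [::] phi j.
pose test (l : literal n) :=
  (odd l.1 == sp) && (odd (x %/ 2 ^ (l.1 %/ 2)) == l.2).
pose f i := nat_of_bool (~~ (j < size phi) || has test (take i cl)).
pose c := if j < size phi then size cl else 0.
have -> : nat_of_bool (half_sat phi sp x j) = f c.
  rewrite /f /half_sat /c -leqNgt; case: ltnP => //= _.
  by rewrite take_size.
apply: yields_iter.
- apply: (@tameP 7) => //; rewrite [LHS]/= Ite_bool /c; case: ltnP => // ltj.
  rewrite mul1n agree; last by rewrite -[clause_pos _ _]addn0; apply: clause_pos_lt.
  by rewrite nth_clause_pos.
- apply: (@tameP 7) => //.
  by rewrite [LHS]/= /f take0 /= orbF; case: (j < size phi).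
- rewrite /c; case: ltnP => // ltj; apply: leq_trans Q_large.
  have incl : cl \in phi by exact: mem_nth.
  by move: phi_kcnf => /andP[_ /allP/(_ _ incl)]; lia.
rewrite /c; case: (ltnP j (size phi)) => // ltj i lti.
have [l0 _] : exists l : literal n, true by case: (cl) lti => // l0; exists l0.
pose lit := nth l0 cl i.
have m_lit : m (clause_pos phi (inb * j) + i + 1) = lit.1.*2 + lit.2.
  rewrite ltj mul1n -addnA addn1 agree; last exact: clause_pos_lt.
  by rewrite nth_enc //= (nth_map l0).
have fS : f i.+1 = (0 < f i + test lit).
  rewrite /f (take_nth l0) // has_rcons -/lit.
  by case: (j < size phi); case: (has _ _); case: (test lit).
have div2 : (lit.1.*2 + lit.2) %/ 2 = lit.1 by case: lit.2; lia.
have mod2 : (lit.1.*2 + lit.2) %% 2 = lit.2 by case: lit.2; lia.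
apply: (@yields_tame K w Q b m) => //.
  apply: fits_cat; first exact: vars23_fits.
    by rewrite /f; case: (_ || _); lia.
  have incl : cl \in phi by exact: mem_nth.
  by move: phi_kcnf => /andP[_ /allP/(_ _ incl)]; lia.
  by case: (sp).
rewrite [LHS]/= m_lit div2 mod2 fS !modn2 /test.
by case: (odd lit.1); case: (sp); case: odd; case: (lit.2).
Qed.

Lemma write_parent_performs :
  performs w Q X m (vars14 sp ++ [:: v]) (write_parent d sp)
    (upd m (out sp + 2 + v) (tree_par sp v)).
Proof.
have e14 : vars14 sp ++ [:: v] = take 15 vars23 by [].
rewrite e14 /write_parent.
apply: (@performs_let _ _ _ _ _ _ _ g); first exact: (@tameP 1).
rewrite -[_ ++ _]/(take 16 vars23).
apply: (@performs_let _ _ _ _ _ _ _ z); first exact: (@tameP 2).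
rewrite -[_ ++ _]/(take 17 vars23).
apply: (@performs_let _ _ _ _ _ _ _ j); first exact: (@tameP 3).
rewrite -[_ ++ _]/(take 18 vars23).
apply: (@performs_let _ _ _ _ _ _ _ inb); first exact: (@tameP 4).
rewrite -[_ ++ _]/(take 19 vars23).
apply: (@performs_let _ _ _ _ _ _ _ x); first by apply: (@tameP 5) => //=; case: (sp).
rewrite -[_ ++ _]/(take 20 vars23).
apply: (@performs_let _ _ _ _ _ _ _ (clause_pos phi (inb * j))).
  have -> : 20 = size (take 20 vars23) by [].
  apply: (@yields_pos K w Q b m) => //.
  - exact: vars23_fits.
  - exact: (@tameP 6).
  - by have [] := m_good.
  - by lia.
  - exact: clause_number.
  - by have := clause_number; lia.
  - have := clause_number; have [[h _ _ _ _] _] := tree_order_ge phi d_gt1 false.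
    by rewrite /ncoords in h; lia.
rewrite -[_ ++ _]/(take 21 vars23).
apply: (@performs_let _ _ _ _ _ _ _ (half_sat phi sp x j)); first exact: yields_sat.
rewrite -[_ ++ _]/(take 22 vars23).
apply: (@performs_let _ _ _ _ _ _ _ (tree_bit sp g j)).
  rewrite /bitE /tree_bit; case: ifP => spE.
    apply: (@tameP 8) => //; rewrite [LHS]/= spE mul1n.
    by set p := _ < npaths d l true; case: p; case: half_sat.
  apply: (@tameP 8) => //; rewrite [LHS]/= spE mul0n subn0.
  by case: half_sat.
rewrite -[_ ++ _]/(take 23 vars23).
apply: performs_write; first exact: (@tameP 9).
by apply: (@tameP 9) => //=; rewrite ?leq_addl //; exact: eval_parE.
Qed.

End WriteParent.

(** The cell [out sp + 1] of the root is never written. The root is vertex 0, and this cell is still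
    0 because it lies past the formula. *)
Lemma emit_performs m sp : good m ->
  exists m', [/\ performs w Q X m vars8 (emit d sp) m', good m',
    forall a, a < out sp -> m' a = m a,
    forall a, out sp + 2 + tree_order sp <= a -> m' a = m a
  & forall i, i < 2 + tree_order sp -> m' (out sp + i) =
      nth 0 (tree_order sp :: m (out sp + 1) ::
             [seq tree_par sp v | v <- iota 0 (tree_order sp)]) i].
Proof.
move=> m_good; pose K := 8 + d.
have K_lt : K < 2 ^ b by rewrite /K; lia.
pose f i := iteri i (fun v m' => upd m' (out sp + 2 + v) (tree_par sp v))
  (upd m (out sp) (tree_order sp)).
have o_lt : tree_order sp < 2 ^ b by move: b_large; case: (sp); lia.
have leB : B <= out sp by rewrite /out leq_addr.
have good_f i : i <= tree_order sp -> good (f i).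
  elim: i => [|i IH] lti; first by apply: good_upd.
  apply: good_upd; [by apply: IH; lia | by lia |].
  by apply: ltn_trans o_lt; exact: tree_par_lt.
have fE i a : f i a = if a == out sp then tree_order sp
    else if out sp + 2 <= a < out sp + 2 + i then tree_par sp (a - (out sp + 2))
    else m a.
  elim: i => [|i IH] /=.
    rewrite updE; case: eqP => // _; case: ifP => //; lia.
  rewrite updE IH; case: eqP => [->|na].
    rewrite addKn; case: eqP => [|_]; first by lia.
    by case: ifP => //; lia.
  case: eqP => // na'; case: ifP => H1; case: ifP => H2 //; lia.
exists (f (tree_order sp)); split.
- have V i : fits b (take (8 + i) (vars14 sp)).
    by apply/fits_all/allP => y /mem_take; move/allP: (vars14_lt sp); apply.
  have tameP i e val : i <= 6 -> tame K (8 + i) e -> leaves e <= 200 ->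
      eval m (take (8 + i) (vars14 sp)) e = val ->
      yields w Q m (take (8 + i) (vars14 sp)) e val.
    move=> le6 te le ev; apply: (@yields_tame K w Q b m) => //; first exact: m_good.2.
    by rewrite size_take; move: te; case: i le6 ev => [|[|[|[|[|[|[|i]]]]]]].
  rewrite -[vars8]/(take 8 (vars14 sp)) /emit.
  apply: (@performs_let _ _ _ _ _ _ _ (npaths d l sp)).
    by apply: (@tameP 0) => //=; case: (sp).
  rewrite -[_ ++ _]/(take 9 (vars14 sp)).
  apply: (@performs_let _ _ _ _ _ _ _ (path_base d l sp)).
    by apply: (@tameP 1) => //=; case: (sp).
  rewrite -[_ ++ _]/(take 10 (vars14 sp)).
  apply: (@performs_let _ _ _ _ _ _ _ (gadget_base d l sp)).
    by apply: (@tameP 2).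
  rewrite -[_ ++ _]/(take 11 (vars14 sp)).
  apply: (@performs_let _ _ _ _ _ _ _ (gadget_size D sp)).
    by apply: (@tameP 3) => //=; case: (sp).
  rewrite -[_ ++ _]/(take 12 (vars14 sp)).
  apply: (@performs_let _ _ _ _ _ _ _ (tree_order sp)).
    by apply: (@tameP 4) => //=; case: (sp).
  rewrite -[_ ++ _]/(take 13 (vars14 sp)).
  apply: (@performs_let _ _ _ _ _ _ _ (out sp)).
    (* The address of the second tree is computed from the order [U + l * N + N * (7 * D)] of the
       first. *)
    apply: (@tameP 5) => //=; first by case: (sp).
    rewrite /out /tree_order /family_order /gadget_base /path_base /ngadgets /npaths.
    by rewrite /gadget_size !mul0n !addn0 !subn0.
  rewrite -[_ ++ _]/(vars14 sp).
  apply: (@performs_then _ _ _ _ _ _ _ (f 0)).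
    by apply: performs_write; exact: (@tameP 6).
  apply: performs_for => //.
    apply: (@yields_tame K w Q b) => //; last exact: (fits_all (vars14_lt sp)).
    exact: (good_f 0 _).2.
  move=> i lti; apply: write_parent_performs => //.
  by apply: good_f; exact: ltnW.
- exact: good_f.
- by move=> a lta; rewrite fE; case: eqP => [|_]; [lia | case: ifP => //; lia].
- by move=> a lta; rewrite fE; case: eqP => [|_]; [lia | case: ifP => //; lia].
- move=> [|[|i]] lti; rewrite fE.
  + by rewrite addn0 eqxx.
  + rewrite -[X in _ == X]addn0 eqn_add2l /=; case: ifP => //; lia.
  + rewrite -[X in _ == X]addn0 eqn_add2l /= (nth_map 0) ?size_iota; last by lia.
    rewrite nth_iota; last by lia.
    case: ifP => H; last by lia.
    by congr tree_par; lia.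
Qed.

Lemma build_performs : exists m',
  performs w Q X (nth 0 enc) [:: B] (build d) m' /\
  forall a, m' (B + a) =
    nth 0 (encode_tree (sat_tree false) ++ encode_tree (sat_tree true)) a.
Proof.
have m_good : good (nth 0 enc) by exact: good_init.
have [m1 [perf1 good1 low1 high1 out1]] := emit_performs false m_good.
have [m2 [perf2 good2 low2 high2 out2]] := emit_performs true good1.
exists m2; split.
- pose K := 8 + d.
  have K_lt : K < 2 ^ b by rewrite /K; lia.
  have K_gt1 : 1 < K by [].
  have vars8_fits i : fits b (take i vars8).
    apply/fits_all/allP => y /mem_take iny; move/allP: (vars14_lt false); apply.
    by rewrite mem_cat iny.
  have m_lt := m_good.2.
  have tameP i e val : i <= 7 -> tame K (1 + i) e -> leaves e <= 200 ->
      eval (nth 0 enc) (take (1 + i) vars8) e = val ->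
      yields w Q (nth 0 enc) (take (1 + i) vars8) e val.
    move=> le7 te le ev; apply: (@yields_tame K w Q b) => //.
    by rewrite size_take; move: te; case: i le7 ev => [|[|[|[|[|[|[|[|i]]]]]]]].
  have [[h1 h2 h3 h4 h5] [h6 h7 h8 h9]] := tree_order_ge phi d_gt1 false.
  have hD : D = n + size phi + 1 by [].
  have hT := nassign_le n d_gt1.
  have leD : d <= K by rewrite /K leq_addl.
  have d_gt0 : 0 < d by lia.
  have l_le : l <= n.+1 by exact: climb_le.
  rewrite -[[:: B]]/(take 1 vars8) /build.
  apply: (@performs_let _ _ _ _ _ _ _ n); first exact: (@tameP 0).
  rewrite -[_ ++ _]/(take 2 vars8).
  apply: (@performs_let _ _ _ _ _ _ _ (size phi)); first exact: (@tameP 1).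
  rewrite -[_ ++ _]/(take 3 vars8).
  apply: (@performs_let _ _ _ _ _ _ _ D); first exact: (@tameP 2).
  rewrite -[_ ++ _]/(take 4 vars8).
  apply: (@performs_let _ _ _ _ _ _ _ (nassign n)).
    have -> : 4 = size (take 4 vars8) by [].
    apply: (@yields_pow K w Q b) => //; try (rewrite -/(nassign n); lia).
    exact: (@tameP 3).
  rewrite -[_ ++ _]/(take 5 vars8).
  apply: (@performs_let _ _ _ _ _ _ _ l).
    have -> : 5 = size (take 5 vars8) by [].
    apply: (@yields_climb K w Q b) => //; try (rewrite -/l; lia).
    - exact: (@tameP 4).
    - move=> vs'; split=> //=; split=> //.
      by apply: leq_trans (_ : 2 ^ b <= _); [lia | rewrite leq_exp2l //; lia].
  rewrite -[_ ++ _]/(take 6 vars8).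
  apply: (@performs_let _ _ _ _ _ _ _ N).
    have -> : 6 = size (take 6 vars8) by [].
    apply: (@yields_pow K w Q b) => //; try lia.
    exact: (@tameP 5).
  rewrite -[_ ++ _]/(take 7 vars8).
  apply: (@performs_let _ _ _ _ _ _ _ U).
    have -> : 7 = size (take 7 vars8) by [].
    apply: (@yields_offset K w Q b) => //; try lia.
    by apply: (@tameP 6) => //; rewrite [LHS]/= addn1.
  rewrite -[_ ++ _]/vars8.
  exact: performs_then perf1 perf2.
have outF : out false = B by rewrite /out mul0n addn0.
have outT : out true = B + (2 + tree_order false) by rewrite /out mul1n.
rewrite outF in low1 high1 out1; rewrite outT in low2 high2 out2.
have zero a : B <= a -> nth 0 enc a = 0 by move=> lea; rewrite nth_default.
have sz sp : size (encode_tree (sat_tree sp)) = 2 + tree_order sp.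
  by rewrite encode_sat_tree /= size_map size_iota.
move=> a; rewrite nth_cat sz.
case: ltnP => lta; rewrite encode_sat_tree.
  rewrite low2; last by lia.
  by rewrite out1 ?zero //; lia.
have [lta2|lea2] := ltnP (a - (2 + tree_order false)) (2 + tree_order true).
  have -> : B + a = B + (2 + tree_order false) + (a - (2 + tree_order false)) by lia.
  by rewrite out2 // high1 ?zero //; lia.
rewrite nth_default; last by rewrite -encode_sat_tree sz.
by rewrite high2 ?high1 ?zero //; lia.
Qed.

End Emit.

(** * Size bounds *)

Lemma poly_bounded_exp f k : poly_bounded f -> poly_bounded (fun Q => f Q ^ k).
Proof.
move=> pf; elim: k => [|k IH].
  by apply: poly_bounded_leq (poly_bounded_const 1) => Q; rewrite expn0.
by apply: poly_bounded_leq (poly_bounded_mul pf IH) => Q; rewrite expnS.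
Qed.

Lemma poly_bounded_comp f g : poly_bounded f -> poly_bounded g -> poly_bounded (f \o g).
Proof.
move=> [K HK] pg; apply: (@poly_bounded_leq _ (fun n => K * (g n + 1) ^ K)).
  by move=> n; rewrite addn1; exact: HK.
apply: poly_bounded_mul (poly_bounded_const K) (poly_bounded_exp _ _).
exact: poly_bounded_add pg (poly_bounded_const 1).
Qed.

Lemma offset_lt d k : 1 < d -> offset d k < d ^ k.
Proof.
move=> d_gt1; elim: k => // k IH; rewrite offsetS expnS.
by have : 2 * d ^ k <= d * d ^ k; [rewrite leq_mul2r d_gt1 orbT | lia].
Qed.

Section Sizes.
Variables (d n : nat) (phi : cnf n).
Hypothesis d_gt1 : 1 < d.

Local Notation D := (ncoords phi).
Local Notation l := (depth_of d n).
Local Notation N := (d ^ l).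

Definition ncoords_log := up_log 2 D.
Local Notation L := ncoords_log.

(* The bound on the tree sizes: the factor [d ^ (L + 5)], polynomial in the size
   of the formula, makes [2 * log_d] of it an upper bound on the heights. *)
Definition size_bound := d ^ (l + L + 5).

Lemma ncoords_le : D <= 2 ^ L.
Proof. exact: up_logP. Qed.

Lemma tree_order_le sp : tree_order d phi sp <= size_bound.
Proof.
have lt_off := offset_lt l d_gt1; have N1 := N_gt1 n d_gt1.
have U_le : offset d l.+1 <= 2 * N by rewrite offsetS; lia.
have l_le : l <= D by have := climb_le d (nassign n) n; rewrite /ncoords /depth_of; lia.
have Np_le : npaths d l sp <= N by rewrite /npaths; lia.
have ng_le : ngadgets d l sp <= 2 * N by rewrite /ngadgets; case: sp Np_le => /=; lia.
have Z_le : gadget_size D sp <= 8 * D by rewrite /gadget_size; case: sp {Np_le ng_le} => /=; lia.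
have pb_le : path_base d l sp <= 4 * N.
  by rewrite /path_base; case: sp {Np_le ng_le Z_le} => /=; lia.
have paths_le : l * npaths d l sp <= D * N by rewrite leq_mul.
have gads_le : ngadgets d l sp * gadget_size D sp <= 2 * N * (8 * D) by rewrite leq_mul.
have D_ge1 := D_gt0 phi.
(* The constant is rounded up to [32 = 2 ^ 5], which the 5 in the exponent of [size_bound]
   absorbs. *)
have total : tree_order d phi sp <= 32 * (N * D).
  rewrite /tree_order /family_order /gadget_base.
  have : N <= N * D by rewrite leq_pmulr.
  by lia.
apply: leq_trans total _; rewrite /size_bound !expnD mulnC leq_mul //; last first.
  by rewrite -[32]/(2 ^ 5) leq_exp2r.
rewrite leq_mul2l; apply/orP; right; apply: leq_trans ncoords_le _.
by have [->//|L_gt0] := posnP L; rewrite leq_exp2r.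
Qed.

Lemma size_bound_gt1 : 1 < size_bound.
Proof. by rewrite -(expn0 d) ltn_exp2l //; lia. Qed.

(** The padding is polynomial since [d ^ L <= (2 ^ d) ^ L = (2 ^ L) ^ d] and [2 ^ L <= 2 * D]. *)
Lemma size_bound_le : size_bound <= nassign n * (d ^ 6 * (2 * D) ^ d).
Proof.
have d_gt0 : 0 < d by lia.
have T_gt0 : 0 < nassign n by rewrite expn_gt0.
have N_le : N <= d * nassign n by exact: climb_tight.
have D_ge1 := D_gt0 phi.
have L_le : 2 ^ L <= 2 * D.
  rewrite /ncoords_log; have [D_le1|D_gt1] := leqP D 1.
    by have -> : D = 1; [lia | rewrite up_log1].
  have L_gt0 : 0 < up_log 2 D by rewrite up_log_gt0.
  by rewrite -(prednK L_gt0) expnS leq_mul2l ltnW // up_log_gtn.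
have dL_le : d ^ L <= (2 * D) ^ d.
  apply: (@leq_trans ((2 ^ d) ^ L)).
    by have [->//|L_gt0] := posnP L; rewrite leq_exp2r // ltnW // ltn_expl.
  by rewrite -expnM mulnC expnM leq_exp2r.
rewrite /size_bound !expnD.
apply: (@leq_trans (d * nassign n * (2 * D) ^ d * d ^ 5)).
  by rewrite !leq_mul.
by rewrite (expnS d 5); lia.
Qed.

End Sizes.

Lemma size_bound_le_poly (d k : nat) (d_gt1 : 1 < d) :
  exists2 g, poly_bounded g &
    forall n (phi : cnf n), kcnf k phi -> size_bound d phi <= nassign n * g n.
Proof.
exists (fun n => d ^ 6 * (2 * (n + (2 * n + 1) ^ k + 1)) ^ d).
  apply: poly_bounded_mul (poly_bounded_const _) _; apply: poly_bounded_exp.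
  apply: poly_bounded_mul (poly_bounded_const 2) _.
  apply: poly_bounded_add (poly_bounded_const 1).
  apply: poly_bounded_add poly_bounded_id _; apply: poly_bounded_exp.
  apply: poly_bounded_add (poly_bounded_const 1).
  exact: poly_bounded_mul (poly_bounded_const 2) poly_bounded_id.
move=> n phi /kcnf_size m_le; apply: leq_trans (size_bound_le phi d_gt1) _.
rewrite leq_mul2l; apply/orP; right; rewrite leq_mul2l; apply/orP; right.
by rewrite leq_exp2r /ncoords; lia.
Qed.

(** This is why words of [O(n)] bits can hold all numbers that occur. *)
Lemma poly_bounded_lt_expn K n : nassign n * (K * n.+1 ^ K) < 2 ^ ((2 * K + 1) * n.+1).
Proof.
have T_le : nassign n <= 2 ^ n.+1 by rewrite leq_exp2l //; lia.
have K_lt : K < 2 ^ (K * n.+1).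
  by apply: (@leq_trans (2 ^ K)); [exact: ltn_expl | rewrite leq_exp2l // leq_pmulr].
have pow_le : n.+1 ^ K <= 2 ^ (K * n.+1).
  by rewrite mulnC expnM; case: K {K_lt} => // K; rewrite leq_exp2r // ltnW // ltn_expl.
have -> : (2 * K + 1) * n.+1 = n.+1 + (K * n.+1 + K * n.+1) by lia.
rewrite !expnD; apply: leq_ltn_trans (leq_mul T_le (leq_mul (leqnn K) pow_le)) _.
by rewrite ltn_pmul2l ?expn_gt0 // ltn_pmul2r ?expn_gt0.
Qed.

(** [C1] is quantified after [q] and [g] because the constant of the final word size must also bound
    the running time, which depends on [g]. *)
Lemma reduction_exec (d k C : nat) (p : prog) (d_gt1 : 1 < d) :
  exists (q : prog) (C0 : nat) (g : nat -> nat), poly_bounded g /\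
  forall C1 n (phi : cnf n), C0 <= C1 -> kcnf k phi -> forall t s,
  exec (C * up_log 2 (size_bound d phi)) p
    (init (encode_tree (sat_tree phi d_gt1 false) ++
           encode_tree (sat_tree phi d_gt1 true))) t s ->
  exists t' s', [/\ exec (C1 * n.+1) q (init (encode_cnf phi)) t' s',
                    t' <= nassign n * g n + 2 * t & reg s' 0 = reg s 0].
Proof.
have [R0 below0] := uses_below_exists p.
pose R := R0.+1; have below : uses_below R p by exact: uses_below_mono below0.
pose endE := posE (Read (Lit 1)) 0.
have [f pf f_cost] := ccost_flat (build_flat d).
have [h ph M_bound] := size_bound_le_poly k d_gt1.
pose mx n := (2 * n + 1) ^ k.
(* Loops inside expressions run over variables, levels, clauses, or the at most [k] literals of a
   clause. *)
pose Qn n := n + mx n + k + 2.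
(* The summands stand for the formula, the two trees relative to [nassign n], and the constants of
   [b_large]. *)
pose r n := 2 + mx n * (k + 1) + 2 * h n + (d + k + 10).
have p_mx : poly_bounded mx.
  apply: poly_bounded_exp; apply: poly_bounded_add (poly_bounded_const 1).
  exact: poly_bounded_mul (poly_bounded_const 2) poly_bounded_id.
have p_Q : poly_bounded Qn.
  apply: poly_bounded_add (poly_bounded_const 2).
  apply: poly_bounded_add (poly_bounded_const k).
  exact: poly_bounded_add poly_bounded_id p_mx.
have p_r : poly_bounded r.
  apply: poly_bounded_add (poly_bounded_const _); apply: poly_bounded_add.
    apply: poly_bounded_add (poly_bounded_const 2) _.
    exact: poly_bounded_mul p_mx (poly_bounded_const _).
  exact: poly_bounded_mul (poly_bounded_const 2) ph.
have [K r_le] := p_r.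
(* Register [R] receives the end of the formula, which is both the initial variable of [build] and
   the base address for [p]. *)
pose q := Seq (compile [::] R endE)
  (Seq (ccompile [:: R] R.+1 (build d)) (relocate R R.+1 p)).
(* Values fit into [b = (2 * K + 1) * n.+1] bits. Expressions take [200 * b] bits and the relocated
   run [C * b + b + 1]; both are at most [(C + 202) * b]. *)
exists q, ((C + 202) * (2 * K + 1)), (fun n => cost (Qn n) endE + f (Qn n) * (r n + 1)).
split.
  apply: poly_bounded_add; first exact: poly_bounded_comp (cost_poly_bounded endE) p_Q.
  apply: poly_bounded_mul; first exact: poly_bounded_comp pf p_Q.
  exact: poly_bounded_add p_r (poly_bounded_const 1).
move=> C1 n phi leC1 kphi t s exec_p.
pose b := (2 * K + 1) * n.+1; pose w := C1 * n.+1.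
have b_gt0 : 0 < b by rewrite muln_gt0; lia.
have w_ge : (C + 202) * b <= w by rewrite /b /w mulnA leq_mul2r leC1 orbT.
have T_gt0 : 0 < nassign n by rewrite expn_gt0.
have Tr_lt : nassign n * r n < 2 ^ b.
  by apply: leq_ltn_trans (poly_bounded_lt_expn K n); rewrite leq_mul2l r_le orbT.
have m_le : size phi <= mx n by exact: kcnf_size.
have B_le : size (encode_cnf phi) <= 2 + mx n * (k + 1).
  by apply: leq_trans (size_encode_cnf kphi) _; rewrite leq_add2l leq_mul2r m_le orbT.
have M_le := M_bound n phi kphi.
have o_le sp : tree_order d phi sp <= size_bound d phi by exact: tree_order_le.
have le_r c : c <= nassign n * c by rewrite leq_pmull.
have fit : size (encode_cnf phi) + tree_order d phi false + tree_order d phi true +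
    d + k + 10 <= nassign n * r n.
  rewrite /r 2!mulnDr mulnCA.
  have := le_r (2 + mx n * (k + 1)); have := le_r (d + k + 10).
  have := o_le false; have := o_le true; lia.
have b_large := leq_ltn_trans fit Tr_lt.
pose Q := Qn n; pose X := nassign n * r n.
have Q_large : n + size phi + k + 2 <= Q by rewrite /Q /Qn; lia.
have X_large sp : tree_order d phi sp <= X by rewrite /X; case: sp; lia.
have w200 : 200 * b <= w by apply: leq_trans w_ge; rewrite leq_mul2r; lia.
have w_gt0 : 0 < w by lia.
set B := size (encode_cnf phi) in fit b_large B_le *.
pose s0 := init (encode_cnf phi).
have s0_good : good phi b (mem s0).
  by apply: (good_init d_gt1 kphi b_gt0 w200 b_large Q_large).
have [safe_end eval_end] : yields w Q (mem s0) [::] endE B.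
  rewrite /B -clause_pos_size; apply: (@yields_pos 8 w Q b) => //; try lia.
  - exact: s0_good.2.
  - by move=> i; rewrite nth_nil expn_gt0.
  - apply: (@yields_tame 8 w Q b) => //; try lia; first exact: s0_good.2.
    by move=> i; rewrite nth_nil expn_gt0.
  - have [[ge7 _ _ _ _] _] := tree_order_ge phi d_gt1 false.
    by rewrite /ncoords in ge7; lia.
have s0_holds : holds s0 R [::] [::] by [].
have [t1 [s1 [ex1 le1 m1 v1 keep1]]] := compileP w_gt0 safe_end erefl s0_holds.
have [m2 [[safe_b run_b] m2E]] :=
  build_performs d_gt1 kphi b_gt0 w200 b_large Q_large X_large.
have s1_holds : holds s1 R.+1 [:: R] [:: B].
  by split=> // -[] //= _; rewrite v1 eval_end.
rewrite -[nth 0 _]/(mem s0) -m1 in safe_b run_b.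
have [t2 [s2 [ex2 le2 mem2 keep2]]] := ccompileP w_gt0 safe_b s1_holds.
set inp := _ ++ _ in exec_p m2E.
(* The registers below [R] are still 0, since only [R] and later ones have been used so far. *)
have mirror : mirrors R B (init inp) s2.
  split.
  - by move=> i lti; rewrite keep2 ?keep1 //; lia.
  - by rewrite keep2 // v1 eval_end.
  - by move=> x; rewrite mem2 run_b m2E.
have logM : up_log 2 (size_bound d phi) <= b.
  apply: up_log_min => //; apply: leq_trans (ltnW Tr_lt).
  by apply: leq_trans M_le _; rewrite leq_mul2l /r; lia.
set w0 := C * _ in exec_p.
have w0_fits : 2 ^ w0 + B <= 2 ^ w.
  have le0 : 2 ^ w0 <= 2 ^ (C * b) by rewrite leq_exp2l // leq_mul2l logM orbT.
  have B_lt : B <= 2 ^ b by lia.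
  have le_sum : 2 ^ (C * b) + 2 ^ b <= 2 ^ (C * b + (b + 1)).
    rewrite !expnD expn1; have := expn_gt0 2 (C * b); have := expn_gt0 2 b.
    by rewrite /= => ? ?; nia.
  apply: (@leq_trans (2 ^ (C * b + (b + 1)))); first by lia.
  by rewrite leq_exp2l //; lia.
have init_lt i : reg (init inp) i < 2 ^ w0 by rewrite /= expn_gt0.
have [_ [t3 [s3 [ex3 le3 [same3 _ _]]]]] :=
  relocateP w0_fits exec_p below init_lt mirror.
exists (t1 + (t2 + t3)), s3; split.
- exact: ExecSeq ex1 (ExecSeq ex2 ex3).
- have le2' := leq_trans le2 (f_cost Q X).
  have le1' : cost Q endE <= nassign n * cost Q endE by rewrite leq_pmull.
  have leX : f Q * X.+1 <= nassign n * (f Q * (r n + 1)).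
    rewrite mulnCA leq_mul2l mulnDr muln1 -addn1 leq_add2l; lia.
  by rewrite -/Q mulnDr; lia.
- by rewrite same3.
Qed.

Import Order.TTheory GRing.Theory Num.Theory.
Local Open Scope ring_scope.

(** * Real exponents *)

Section RealBounds.
Variables (R : realType).

Lemma nassign_powR n : (nassign n)%:R = 2 `^ ((n + 1) %/ 2)%N%:R :> R.
Proof. by rewrite powR_mulrn // natrX. Qed.

(** Writing the trees takes about [2 ^ (n / 2)] steps, within the target because [e <= 1] gives
    [1 - e / 2 >= 1 / 2]. The factor 2 absorbs the rounding. *)
Lemma nassign_powR_le (e : R) n : 0 <= e <= 1 ->
  (nassign n)%:R <= 2 * 2 `^ ((1 - e / 2) * n%:R) :> R.
Proof.
move=> /andP[e_ge0 e_le1].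
have h_le : ((n + 1) %/ 2)%N%:R <= (n%:R + 1) / 2 :> R.
  rewrite ler_pdivlMr // -natrM natr1 ler_nat addn1; exact: leq_trunc_div.
have n_ge0 : 0 <= n%:R :> R by [].
have en_le : e * n%:R <= n%:R by rewrite ler_piMl.
have two : 2 = 2 `^ 1 :> R by rewrite powRr1.
rewrite nassign_powR [X in _ <= X * _]two -powRD; last by rewrite pnatr_eq0 implybT.
apply: ler_powR; first by rewrite ler1n.
by rewrite mulrBl mul1r mulrAC; lra.
Qed.

(** A saving of [e] in the exponent 2 becomes one of [e / 2] for [2 ^ n], as [(n + 1) / 2 * (2 - e)
    <= (1 - e / 2) * n + 1]. *)
Lemma nassign_powR_2e (e : R) n : 0 <= e <= 1 ->
  (nassign n)%:R `^ (2 - e) <= 2 * 2 `^ ((1 - e / 2) * n%:R) :> R.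
Proof.
move=> /andP[e_ge0 e_le1].
have h_le : ((n + 1) %/ 2)%N%:R <= (n%:R + 1) / 2 :> R.
  rewrite ler_pdivlMr // -natrM natr1 ler_nat addn1; exact: leq_trunc_div.
have two : 2 = 2 `^ 1 :> R by rewrite powRr1.
rewrite nassign_powR -powRrM [X in _ <= X * _]two -powRD; last by rewrite pnatr_eq0 implybT.
apply: ler_powR; first by rewrite ler1n.
apply: (@le_trans _ _ ((n%:R + 1) / 2 * (2 - e))); first by rewrite ler_wpM2r //; lra.
have n_ge0 : 0 <= n%:R :> R by [].
by lra.
Qed.

Lemma powR_size_bound (e : R) n m P : 0 <= e <= 1 -> (0 < m)%N ->
  (m <= nassign n * P)%N ->
  m%:R `^ (2 - e) <= 2 * 2 `^ ((1 - e / 2) * n%:R) * P%:R ^+ 2 :> R.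
Proof.
move=> /[dup] e01 /andP[e_ge0 e_le1] m_gt0 m_le.
have P_gt0 : (0 < P)%N by case: P m_le => //; rewrite muln0; case: m m_gt0.
apply: (@le_trans _ _ ((nassign n * P)%:R `^ (2 - e))).
  by rewrite ge0_ler_powR ?nnegrE ?ler_nat //; lra.
rewrite natrM powRM //; apply: ler_pM; rewrite ?powR_ge0 //.
  exact: nassign_powR_2e.
by rewrite -powR_mulrn //; apply: ler_powR; rewrite ?ler1n //; lra.
Qed.

(** [size_bound] is a power of [d], so its logarithm is an integer and the heights are compared as
    naturals; as it is at least 2, the iterated logarithm is nonnegative. *)
Lemma sat_tree_admissible d n (phi : cnf n) (d_gt1 : (1 < d)%N) sp :
  admissible d (1 : R) (size_bound d phi) (sat_tree phi d_gt1 sp).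
Proof.
have M_gt1 := size_bound_gt1 phi d_gt1.
split; first exact: (tree_order_le phi d_gt1 sp).
  exact: sat_tree_nchildren.
have height_le := sat_tree_height d_gt1 sp (ncoords_le phi).
have lnd_gt0 : 0 < ln d%:R :> R by rewrite ln_gt0 // ltr1n.
have ln2_gt0 : 0 < ln 2 :> R by rewrite ln_gt0 // ltr1n.
have logdM : logb d%:R (size_bound d phi)%:R = (depth_of d n + ncoords_log phi + 5)%:R :> R.
  rewrite /logb /size_bound natrX lnXn ?ltr0n; last by lia.
  by rewrite -[ln _ *+ _]mulr_natl mulfK ?gt_eqF.
have log2M : 1 <= logb 2 (size_bound d phi)%:R :> R.
  rewrite /logb ler_pdivlMr // mul1r ler_ln ?posrE ?ltr0n ?ler_nat //; lia.
have loglog : 0 <= logb 2 (logb 2 (size_bound d phi)%:R) :> R.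
  by rewrite {1}/logb; apply: divr_ge0; [apply: ln_ge0 | exact: ltW].
rewrite logdM mul1r; apply: (@le_trans _ _ (2 * (depth_of d n + ncoords_log phi + 5)%:R)).
  rewrite -natrM ler_nat; apply: leq_trans height_le _; lia.
by rewrite lerDl.
Qed.

End RealBounds.

Unset Implicit Arguments.

Theorem theorem1p1 (R : realType) (d : nat) (hd : (2 <= d)%N) :
  exists c : R, 0 < c /\
    ((exists e : R, 0 < e /\ subtree_iso_solvable d c e) -> ~ SETH R).
Proof.
exists 1; split=> // -[e [e_gt0 [p [C solve]]]] seth.
(* Capping [e] at 1 only weakens the assumed running time, and keeps the writing of the trees within
   the target. *)
pose e0 := Num.min e 1.
have e0_gt0 : 0 < e0 by rewrite lt_min e_gt0 ltr01.
have e01 : 0 <= e0 <= 1 by rewrite ltW //= ge_min lexx orbT.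
have [|k unsolvable] := seth (e0 / 2); first by rewrite divr_gt0.
apply: unsolvable.
have [q [C0 [g [pg run_q]]]] := reduction_exec k C p hd.
have [P pP P_le] := size_bound_le_poly k hd.
(* With [E] the exponential factor, [nassign n <= 2 * E] and [t <= C * (2 * E * P n ^ 2)]; this is
   then the coefficient of [E] in [nassign n * g n + 2 * t]. *)
have [K K_le] : poly_bounded (fun n => 2 * g n + 4 * C * P n ^ 2)%N.
  apply: poly_bounded_add; first exact: poly_bounded_mul (poly_bounded_const 2) pg.
  exact: poly_bounded_mul (poly_bounded_const _) (poly_bounded_exp 2 pP).
(* One constant serves for the word size, where [C0] is needed, and for the factor and the degree of
   the time bound, where [K] is. *)
exists q, (C0 + K)%N => n phi kphi.
have [t [s [exec_p t_le answer]]] := solve _ _ _ (size_bound_gt1 phi hd)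
  (sat_tree_admissible R phi hd false) (sat_tree_admissible R phi hd true).
have [t' [s' [exec_q t'_le eq_reg]]] := run_q _ n phi (leq_addr K C0) kphi _ _ exec_p.
exists t', s'; split=> //; last first.
  rewrite eq_reg; apply: (iff_trans answer).
  exact: sat_trees_iso.
set E := 2 `^ _.
have E_ge0 : 0 <= E by exact: powR_ge0.
have M_gt1 := size_bound_gt1 phi hd.
have t_le' : t%:R <= C%:R * (2 * E * (P n)%:R ^+ 2) :> R.
  apply: le_trans t_le _; rewrite ler_wpM2l //.
  apply: le_trans (powR_size_bound e01 (ltnW M_gt1) (P_le n phi kphi)).
  by apply: ler_powR; [rewrite ler1n ltnW | rewrite lerD2l lerN2 ge_min lexx].
have T_le : (nassign n)%:R <= 2 * E :> R by exact: nassign_powR_le.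
apply: (@le_trans _ _ (E * (2 * g n + 4 * C * P n ^ 2)%N%:R)).
  apply: le_trans (_ : (nassign n * g n + 2 * t)%N%:R <= _); first by rewrite ler_nat.
  rewrite natrD (natrM _ (nassign n)) (natrM _ 2).
  rewrite natrD (natrM _ 2) (natrM _ (4 * C)) (natrM _ 4) (natrX _ (P n)).
  have Tg : (nassign n)%:R * (g n)%:R <= 2 * E * (g n)%:R :> R by rewrite ler_wpM2r.
  lra.
rewrite [_ * E]mulrC -mulrA ler_wpM2l //.
rewrite -natrX -natrM ler_nat; apply: leq_trans (K_le n) _.
apply: leq_mul; first exact: leq_addl.
by rewrite leq_pexp2l // leq_addl.
Qed.
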